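(* Let $(V,\sigma)$ be a one-sided subshift. Then $(V,\sigma)$ can be embedded into a dynamical system on the Gehman dendrite in such a way that each invariant measure is a convex combination of the trivial measure and an invariant measure of $(V,\sigma)$. That is, there exist a continuous map $f\colon D\to D$ on the Gehman dendrite $D$, a point $c\in D$ with $f(c)=c$, and an injective continuous map $\phi\colon V\to D$ with $\phi\circ\sigma=f\circ\phi$, such that every $f$-invariant Borel probability measure $\mu$ on $D$ is of the form $\mu=t\,\delta_c+(1-t)\,\phi_*\nu$ for some $t\in[0,1]$ and some $\sigma$-invariant Borel probability measure $\nu$ on $V$.
   Context: A one-sided subshift $(V,\sigma)$ is a non-empty closed subset $V\subset\mathcal{A}^{\{0,1,2,\dots\}}$, for a finite alphabet $\mathcal{A}$, with $\sigma(V)\subset V$, where $\sigma$ is the left shift. A dendrite is a locally connected continuum (compact connected metric space) containing no simple closed curve. The Gehman dendrite is the topologically unique dendrite whose set of all endpoints is homeomorphic to the Cantor set and whose branching points are all of order three. Here the order (valence) of a point $v$ is the supremum of the numbers $n$ such that there are $n$ arcs in the space with common endpoint $v$ that pairwise intersect only at $v$; endpoints are the points of order $1$ and branching points are the points of order at least $3$. The trivial measure is the Dirac measure $\delta_c$ at a fixed point $c$ of $f$. *)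

(* Defs.v *)
From HB Require Import structures.
From mathcomp Require Import all_boot all_order all_algebra.
From mathcomp Require Import all_classical all_reals all_analysis.

Set Implicit Arguments.
Unset Strict Implicit.
Unset Printing Implicit Defensive.

Import Order.TTheory GRing.Theory Num.Theory.
Import numFieldNormedType.Exports.
Local Open Scope classical_set_scope.
Local Open Scope ring_scope.

(* The library's measurable types are pointed, so Borel probabilities live on
   pointed spaces. Every space considered here is non-empty, and the choice of
   the point plays no role. *)
#[short(type="pmetricType")]
HB.structure Definition PointedMetric (R : numDomainType) :=
  {T of Metric R T & Pointed T}.

Definition homeomorphism_on (S T : topologicalType) (A : set S) (B : set T)
    (f : S -> T) (g : T -> S) : Prop :=
  [/\ set_fun A B f, set_fun B A g,
      {in A, cancel f g}, {in B, cancel g f} &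
      {within A, continuous f} /\ {within B, continuous g}].

Definition homeomorphic (S T : topologicalType) (A : set S) (B : set T) : Prop :=
  exists (f : S -> T) (g : T -> S), homeomorphism_on A B f g.

Definition locally_connected (T : topologicalType) : Prop :=
  forall (x : T) (U : set T), nbhs x U ->
    exists C : set T, [/\ open C, C x, connected C & C `<=` U].

Section dendrite.
Context (R : realType).

Definition unit_circle : set (R * R) :=
  [set p | p.1 ^+ 2 + p.2 ^+ 2 = 1].

Definition simple_closed_curve (T : topologicalType) (C : set T) : Prop :=
  homeomorphic unit_circle C.

Definition is_arc (T : topologicalType) (a b : T) (A : set T) : Prop :=
  exists (f : R -> T) (g : T -> R),
    [/\ homeomorphism_on `[0%R : R, 1%R : R]%classic A f g, f 0 = a & f 1 = b].

Definition star_of_arcs (T : topologicalType) (v : T) (n : nat) : Prop :=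
  exists (b : 'I_n -> T) (A : 'I_n -> set T),
    (forall i, is_arc v (b i) (A i)) /\
    (forall i j, i != j -> A i `&` A j = [set v]).

Definition point_order (T : topologicalType) (v : T) : \bar R :=
  ereal_sup [set (n%:R)%:E | n in [set n : nat | star_of_arcs v n]].

Definition endpoints (T : topologicalType) : set T :=
  [set v | point_order v = 1%:E].

Definition branching_points (T : topologicalType) : set T :=
  [set v | (3%:R%:E <= point_order v)%E].

Definition dendrite (D : pmetricType R) : Prop :=
  [/\ compact [set: D], connected [set: D], locally_connected D &
      forall C : set D, ~ simple_closed_curve C].

(* Any two spaces satisfying this predicate are homeomorphic, so it determines
   the Gehman dendrite as a topological space. *)
Definition gehman_dendrite (D : pmetricType R) : Prop :=
  [/\ dendrite D,
      homeomorphic (@endpoints D) [set: cantor_space] &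
      forall v : D, branching_points v -> point_order v = 3%:R%:E].

End dendrite.

Definition full_shift (A : finType) : Type :=
  prod_topology (fun _ : nat => discrete_topology A).

HB.instance Definition _ (A : finType) := Topological.on (full_shift A).

Definition shift_map (A : finType) (x : full_shift A) : full_shift A :=
  fun n => x n.+1.

Record subshift (A : finType) := Subshift {
  subshift_set :> set (full_shift A);
  subshift_neq0 : subshift_set !=set0;
  subshift_closed : closed subshift_set;
  subshift_shift : @shift_map A @` subshift_set `<=` subshift_set
}.

Definition subshift_space (A : finType) (V : subshift A) : Type := set_type V.

Section subshift_space.
Context (A : finType) (V : subshift A).

HB.instance Definition _ := Topological.copy (subshift_space V) (set_type V).

Lemma subshift_space_inhabited : exists x : full_shift A, x \in (V : set _).
Proof. by have [x Vx] := subshift_neq0 V; exists x; exact: mem_set. Qed.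

HB.instance Definition _ := isPointed.Build (subshift_space V)
  (let: exist x Vx := cid subshift_space_inhabited in exist _ x Vx).

Lemma shift_in_subshift (x : subshift_space V) :
  shift_map (set_val x) \in (V : set _).
Proof.
apply/mem_set/subshift_shift; exists (set_val x) => //.
exact: set_valP.
Qed.

Definition subshift_map (x : subshift_space V) : subshift_space V :=
  exist _ (shift_map (set_val x)) (shift_in_subshift x).

End subshift_space.

Definition borel (T : ptopologicalType) : Type := g_sigma_algebraType (@open T).

HB.instance Definition _ (T : ptopologicalType) := Measurable.on (borel T).

Definition invariant_measure (R : realType) (T : ptopologicalType) (f : T -> T)
    (mu : set (borel T) -> \bar R) : Prop :=
  forall B : set (borel T), measurable B -> mu (f @^-1` B) = mu B.

(* Main.v *)
Require Import Defs.
From HB Require Import structures.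
From mathcomp Require Import all_boot all_order all_algebra.
From mathcomp Require Import all_classical all_reals all_analysis.
From mathcomp Require Import lra.

(* The Gehman dendrite is realized as the rooted binary tree completed by its
   infinite branches: the branch x of the Cantor set is a segment of length 1,
   and two branches x, y are glued below the height 1 - 2^-n, where n is the
   first bit at which they differ. All topological properties come from the
   resulting ultrametric-like product (p | q), the height at which the paths from
   the root to p and q separate, and from the fact that any point between a and
   b separates a from b, so that every connected set containing a and b contains
   the arc between them.

   A subshift V over A is written in binary, one block of k = #|A| bits per
   letter, and thereby becomes a closed set of endpoints. The map f first
   retracts the dendrite onto the subtree spanned by V, then deletes k bits and
   expands the distance to the top by 2^k. It extends the shift of V, and every
   point outside V has height < 1 after one step, hence reaches the root c after
   finitely many steps. An invariant measure therefore gives the complement of V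
   the same mass as {c}, and normalizing its restriction to V yields nu. When
   this restriction vanishes, some invariant measure of V is needed: it is
   obtained from an ultrafilter limit of visit frequencies along an orbit, a
   finitely additive set function that compactness makes sigma-additive on the
   clopen sets. *)

Set Implicit Arguments.
Unset Strict Implicit.
Unset Printing Implicit Defensive.

Import Order.TTheory GRing.Theory Num.Theory.
Import numFieldNormedType.Exports.
Local Open Scope classical_set_scope.
Local Open Scope ring_scope.

(** * The tree and its metric *)

Section tree.
Context (R : realType).

(** Height of the [n]-th fork of the tree: bit [n] is read just above it. The levels accumulate only
    at the top height 1. *)
Definition level (n : nat) : R := 1 - 2^-1 ^+ n.

Lemma level_lt1 n : level n < 1.
Proof. by rewrite /level ltrBlDr ltrDl exprn_gt0// invr_gt0. Qed.

Lemma level_0 : level 0 = 0.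
Proof. by rewrite /level expr0 subrr. Qed.

Lemma level_lt m n : (level m < level n) = (m < n)%N.
Proof.
rewrite /level ltrD2l ltrN2 ltr_iXn2l ?invr_gt0 ?invf_lt1 ?ltr1n //.
Qed.

Lemma level_le m n : (level m <= level n) = (m <= n)%N.
Proof. by rewrite leNgt level_lt -leqNgt. Qed.

Lemma level_ge0 n : 0 <= level n.
Proof. by rewrite -level_0 level_le. Qed.

Lemma level_unbounded (t : R) : t < 1 -> exists n, t < level n.
Proof.
move=> t1; have : (fun n : nat => (2^-1 : R) ^+ n) @ \oo --> (0 : R).
  by apply: cvg_expr; rewrite ger0_norm// invf_lt1// ltr1n.
move=> /cvgrPdist_lt /(_ (1 - t)); rewrite subr_gt0 => /(_ t1) [n _ nt].
exists n; move: (nt n (leqnn n)); rewrite /= sub0r normrN ger0_norm ?exprn_ge0//.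
by rewrite /level; lra.
Qed.

Implicit Types (x y z : nat -> bool) (s t : R).

(* The height at which the branches [x] and [y] of the tree separate. *)
Definition agree x y : R :=
  if pselect (exists n, x n != y n) is left e then level (ex_minn e) else 1.

Lemma agree_le1 x y : agree x y <= 1.
Proof. by rewrite /agree; case: pselect => // e; exact/ltW/level_lt1. Qed.

(** Characterizes [agree] by its lower bounds, so that later inequalities become statements about
    bits and avoid the search for the first differing bit. *)
Lemma le_agreeP x y s : s <= 1 ->
  s <= agree x y <-> (forall n, level n < s -> x n = y n).
Proof.
move=> s1; rewrite /agree; case: pselect => [e|/forallNP xy].
  case: ex_minnP => k xyk kmin; split=> [sk n ns|xy].
    have := lt_le_trans ns sk; rewrite level_lt => nk.
    by apply/eqP/negPn/negP => /kmin; rewrite leqNgt nk.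
  by rewrite leNgt; apply/negP => /xy /eqP; exact/negP.
by split=> // _ n _; move/negP: (xy n); rewrite negbK => /eqP.
Qed.

Lemma agree_ge0 x y : 0 <= agree x y.
Proof.
by apply/le_agreeP => // n; rewrite ltNge level_ge0.
Qed.

Lemma agree_eq x y n : level n < agree x y -> x n = y n.
Proof.
move=> na; have /le_agreeP := lexx (agree x y).
by apply=> //; exact: agree_le1.
Qed.

Lemma agreexx x : agree x x = 1.
Proof. by apply/le_anti; rewrite agree_le1; apply/le_agreeP. Qed.

Lemma agreeC x y : agree x y = agree y x.
Proof.
by apply/le_anti/andP; split; apply/le_agreeP => [|n /agree_eq//];
  exact: agree_le1.
Qed.

Lemma agree_trans y x z : Num.min (agree x y) (agree y z) <= agree x z.
Proof.
apply/le_agreeP => [|n]; first by rewrite ge_min agree_le1.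
by rewrite lt_min => /andP[/agree_eq -> /agree_eq ->].
Qed.

Lemma agree_level x y n : (forall i, (i < n)%N -> x i = y i) ->
  level n <= agree x y.
Proof.
move=> xy; apply/le_agreeP; first exact/ltW/level_lt1.
by move=> i; rewrite level_lt => /xy.
Qed.

(* The point at height [height] on the branch [bits], encoded canonically: the
   bits read at or above that height are [false]. *)
Record tree : Type := Tree {
  bits : nat -> bool;
  height : R;
  height_itv : 0 <= height <= 1;
  bits_false : forall n, height <= level n -> bits n = false }.

HB.instance Definition _ := gen_eqMixin tree.
HB.instance Definition _ := gen_choiceMixin tree.

Implicit Types p q r : tree.

Lemma height_ge0 p : 0 <= height p. Proof. by case/andP: (height_itv p). Qed.
Lemma height_le1 p : height p <= 1. Proof. by case/andP: (height_itv p). Qed.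

Lemma tree_ext p q : height p = height q -> bits p =1 bits q -> p = q.
Proof.
case: p q => x s hs cx [y t ht cy] /= st /funext xy; subst t y.
by congr Tree; exact: Prop_irrelevance.
Qed.

(** Makes [branch x t] total in [t], so that its continuity can be stated on the whole product with
    [R]. *)
Definition clamp t : R := Num.min 1 (Num.max 0 t).

Lemma clamp_itv t : 0 <= clamp t <= 1.
Proof. by rewrite /clamp le_min ge_min le_max !lexx ler01. Qed.

Lemma clamp_id t : 0 <= t <= 1 -> clamp t = t.
Proof. by move=> /andP[t0 t1]; rewrite /clamp max_r// min_r. Qed.

Lemma branch_subproof x t n :
  clamp t <= level n -> x n && (level n < clamp t) = false.
Proof. by rewrite leNgt => /negbTE ->; rewrite andbF. Qed.

Definition branch x t : tree := Tree (clamp_itv t) (@branch_subproof x t).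

Lemma height_branch x t : 0 <= t <= 1 -> height (branch x t) = t.
Proof. exact: clamp_id. Qed.

Lemma branch_bits p : branch (bits p) (height p) = p.
Proof.
apply: tree_ext => /=; first exact/clamp_id/height_itv.
move=> n /=; rewrite clamp_id ?height_itv//.
by case: ltP => [|/bits_false ->]; rewrite ?andbT.
Qed.

(** The Gromov product based at the root. Both heights cap [agree], since the bits above a point are
    only padding. *)
Definition gromov p q : R :=
  Num.min (Num.min (height p) (height q)) (agree (bits p) (bits q)).

Lemma le_gromovP s p q : s <= gromov p q <->
  [/\ s <= height p, s <= height q &
      forall n, level n < s -> bits p n = bits q n].
Proof.
rewrite /gromov !le_min; split=> [/andP[/andP[sp sq]]|[sp sq sn]].
  by move/le_agreeP => spq; split=> //; apply: spq; rewrite (le_trans sp)// height_le1.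
rewrite sp sq; apply/le_agreeP => //; rewrite (le_trans sp)//; exact: height_le1.
Qed.

Lemma gromov_branch x y s t : 0 <= s <= 1 -> 0 <= t <= 1 ->
  gromov (branch x s) (branch y t) = Num.min (Num.min s t) (agree x y).
Proof.
move=> hs ht; have [/andP[s0 s1] /andP[t0 t1]] := (hs, ht).
apply/le_anti/andP; split.
  have := lexx (gromov (branch x s) (branch y t)).
  move=> /le_gromovP[]; rewrite /= !clamp_id// => ms mt xy.
  rewrite !le_min ms mt/=; apply/le_agreeP; first exact: le_trans s1.
  move=> n nm; move: (xy n nm).
  by rewrite (lt_le_trans nm ms) (lt_le_trans nm mt) !andbT.
apply/le_gromovP; rewrite /= !clamp_id// !ge_min !lexx/= orbT; split=> // n.
by rewrite !lt_min => /andP[/andP[-> ->] /agree_eq ->].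
Qed.

Lemma gromov_ge0 p q : 0 <= gromov p q.
Proof. by rewrite /gromov !le_min !height_ge0 agree_ge0. Qed.

Lemma gromovC p q : gromov p q = gromov q p.
Proof. by rewrite /gromov agreeC [X in Num.min X _]minC. Qed.

Lemma gromovxx p : gromov p p = height p.
Proof. by rewrite /gromov minxx agreexx min_l// height_le1. Qed.

Lemma gromov_lel p q : gromov p q <= height p.
Proof. by rewrite /gromov !ge_min lexx. Qed.

Lemma gromov_ler p q : gromov p q <= height q.
Proof. by rewrite gromovC gromov_lel. Qed.

Lemma gromov_trans q p r : Num.min (gromov p q) (gromov q r) <= gromov p r.
Proof.
have /le_gromovP[? ? pq] := lexx (gromov p q).
have /le_gromovP[? ? qr] := lexx (gromov q r).
apply/le_gromovP; split.
- by rewrite ge_min gromov_lel.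
- by rewrite ge_min gromov_ler orbT.
- by move=> n; rewrite lt_min => /andP[/pq -> /qr].
Qed.

(** Neither point rises above their meet. The canonical padding by [false] is what turns agreement
    below the common height into equality. *)
Lemma gromov_eq p q : height p <= gromov p q -> height q <= gromov p q -> p = q.
Proof.
move=> /le_gromovP[_ pq xy] /le_gromovP[qp _ _].
have e : height p = height q by apply/le_anti; rewrite pq.
apply: tree_ext => // n; have [/xy//|np] := ltP (level n) (height p).
by rewrite !bits_false// -e.
Qed.

(** Length of the path that descends from [p] to the meet and climbs to [q]. *)
Definition tdist p q : R := height p + height q - 2 * gromov p q.

Lemma tdistxx p : tdist p p = 0.
Proof. by rewrite /tdist gromovxx; lra. Qed.

Lemma tdist_eq0 p q : tdist p q = 0 -> p = q.
Proof.
rewrite /tdist => d0; have := gromov_lel p q; have := gromov_ler p q => mq mp.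
by apply: gromov_eq; lra.
Qed.

Lemma tdistC p q : tdist p q = tdist q p.
Proof. by rewrite /tdist gromovC; lra. Qed.

Lemma tdist_triangle q p r : tdist p r <= tdist p q + tdist q r.
Proof.
rewrite /tdist; have := gromov_trans q p r; have := gromov_ler p q.
by have := gromov_lel q r; rewrite minEle; case: ifP; lra.
Qed.

HB.instance Definition _ :=
  isMetric.Build R tree tdistxx tdist_eq0 tdistC tdist_triangle.

Definition tree_root : tree := branch (fun=> false) 0.

HB.instance Definition _ := isPointed.Build tree tree_root.

Lemma tree_ball p e : ball p e = [set q | tdist p q < e].
Proof. by rewrite ballEmdist. Qed.

End tree.

(** * Topology of the tree *)

Section product_topology.
Context (I : Type) (T : I -> topologicalType).

Lemma prod_topology_cvg (F : set_system (prod_topology T)) (x : prod_topology T) :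
  Filter F -> (forall i, (fun y : prod_topology T => y i) @ F --> x i) -> F --> x.
Proof.
move=> FF Fx; apply/cvg_sup => i A.
rewrite nbhsE => -[_ [[B oB <-] Bx] BA].
apply: (@filterS _ F _ _ _ BA); apply: (Fx i).
exact: open_nbhs_nbhs.
Qed.

Lemma coord_continuous (i : I) :
  continuous (fun y : prod_topology T => y i).
Proof.
move=> x A /= xA; have /cvg_sup/(_ i) : nbhs x --> x by exact: cvg_id.
by apply; exact: (@initial_continuous _ _ (fun y : forall i, T i => y i)).
Qed.

End product_topology.

Lemma near_cylinder (T : nat -> topologicalType) (x : prod_topology T) (n : nat) :
  (forall i, nbhs (x i) [set x i]) ->
  nbhs x [set y : prod_topology T | forall i, (i < n)%N -> x i = y i].
Proof.
move=> x1; elim: n => [|n IHn]; first by apply: filterS filterT => y _ i.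
apply: filterS (filterI IHn (coord_continuous (x1 n))) => y [/= yi yn] i.
by rewrite ltnS leq_eqVlt => /predU1P[->|/yi].
Qed.

Section tree_topology.
Context (R : realType).
Local Notation D := (tree R).
Implicit Types (p q r : D) (s t : R).

Global Instance tree_nbhs_filter p : ProperFilter (nbhs p).
Proof. exact: nbhs_pfilter. Qed.

Lemma tree_open (A : set D) :
  (forall p, A p -> exists2 e : R, 0 < e & forall q, tdist p q < e -> A q) ->
  open A.
Proof.
move=> HA; rewrite openE => p /HA [e e0 eA].
by apply/nbhs_ballP; exists e.
Qed.

Lemma continuous_treeP (T : topologicalType) (f : T -> D) :
  continuous f <-> forall x e, 0 < e -> \forall y \near x, tdist (f x) (f y) < e.
Proof.
split=> [cf x e e0|H x].
  have := cf x; move/cvg_ballP => /(_ e e0).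
  by apply: filterS => y; rewrite tree_ball.
by apply/cvg_ballP => e e0; apply: filterS (H x e e0) => y; rewrite tree_ball.
Qed.

Lemma near_tree p e : 0 < e -> \forall q \near p, tdist p q < e.
Proof.
by move=> e0; apply/nbhs_ballP; exists e.
Qed.

Lemma tdist_ge_gromov p q : height p - gromov p q <= tdist p q.
Proof. by rewrite /tdist; have := gromov_ler p q; lra. Qed.

Lemma height_lipschitz p q : `|height p - height q| <= tdist p q.
Proof.
rewrite /tdist ler_norml; have := gromov_ler p q; have := gromov_lel p q.
by move=> ? ?; apply/andP; split; lra.
Qed.

Lemma height_continuous : continuous (@height R).
Proof.
move=> p; apply/cvgrPdist_lt => e e0; apply: filterS (near_tree p e0) => q.
exact/le_lt_trans/height_lipschitz.
Qed.

(** If [(p|r)] exceeds [(q|r)], the ultrametric inequality gives [(p|q) <= (q|r)], and the descent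
    from [p] to its meet with [q] already bounds the difference. *)
Lemma gromov_lipschitz r p q : gromov p r - gromov q r <= tdist p q.
Proof.
have := gromov_trans p q r; have := tdist_ge_gromov p q.
rewrite [gromov q p]gromovC; have := gromov_lel p r; have := gromov_lel p q.
by rewrite minEle; case: ifP; lra.
Qed.

Lemma branch_dist (x y : nat -> bool) s t : 0 <= s <= 1 -> 0 <= t <= 1 ->
  tdist (branch x s) (branch y t) =
  s + t - 2 * Num.min (Num.min s t) (agree R x y).
Proof. by move=> hs ht; rewrite /tdist gromov_branch// !height_branch. Qed.

Lemma clamp_lipschitz s t : `|clamp s - clamp t| <= `|s - t|.
Proof.
rewrite /clamp !maxEle !minEle; do ! case: ifPn;
  rewrite -?ltNge ler_norml => *; have := ler_norm (s - t); have := ler_norm (t - s);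
  rewrite [`|t - s|]distrC => *; apply/andP; split; lra.
Qed.

Lemma branch_clamp (x : nat -> bool) t : branch x t = branch x (clamp t).
Proof.
have e : clamp (clamp t) = clamp t by exact/clamp_id/clamp_itv.
by apply: tree_ext => [|n] /=; rewrite e.
Qed.

Lemma branch_continuous :
  continuous (fun z : cantor_space * R => branch z.1 z.2 : D).
Proof.
apply/continuous_treeP => -[x s] e e0 /=.
(* Once [n] bits agree, the product is either the smaller height, which gives distance [|s' - t'|],
   or at least [1 - e / 4], which gives distance at most [e / 2] because heights are at most 1. *)
have [n en] : exists n, 1 - e / 4 < level R n.
  by apply: level_unbounded; lra.
have e2 : 0 < e / 2 by lra.
exists ([set y | forall i, (i < n)%N -> x i = y i], [set t | `|s - t| < e / 2]).
  split=> /=.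
    by apply: (@near_cylinder (fun=> bool)) => i; exact: discrete_set1.
  by apply/nbhs_ballP; exists (e / 2).
move=> [y t] [/= xy st].
rewrite (branch_clamp x s) (branch_clamp y t) branch_dist; try exact: clamp_itv.
have nxy : level R n <= agree R x y by exact: agree_level.
have := clamp_lipschitz s t; have /andP[_ ] := clamp_itv s.
have /andP[_ ] := clamp_itv t; move: (clamp s) (clamp t) => s' t' t1 s1 st'.
have := le_lt_trans st' st; rewrite ltr_norml => /andP[? ?].
by rewrite !minEle; do !case: ifP; lra.
Qed.

(** The tree is the continuous image of the product of the Cantor space and the unit interval under
    [branch]. *)
Lemma tree_compact : compact [set: D].
Proof.
have /(continuous_compact (continuous_subspaceT branch_continuous)) :
    compact ([set: cantor_space] `*` `[0%R : R, 1%R : R]%classic).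
  by apply: compact_setX; [exact: cantor_space_compact|exact: segment_compact].
rewrite (_ : _ @` _ = setT)//; apply/seteqP; split=> // p _.
exists (bits p, height p); last exact: branch_bits.
by split=> //=; rewrite in_itv/= height_itv.
Qed.

(** * Separation, arcs and local connectedness *)

Definition cut p s : D := branch (bits p) s.

Lemma cut_continuous p : continuous (cut p).
Proof.
move=> s; apply: (@continuous_comp _ _ _ (fun s => (bits p : cantor_space, s))
  (fun z : cantor_space * R => branch z.1 z.2 : D)).
  by apply: (@cvg_pair _ _ _ _ (nbhs (bits p : cantor_space)) (nbhs s));
    [exact: cvg_cst|exact: cvg_id].
exact: branch_continuous.
Qed.

Lemma cut_height p : cut p (height p) = p.
Proof. exact: branch_bits. Qed.

Lemma height_cut p s : 0 <= s <= 1 -> height (cut p s) = s.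
Proof. exact: height_branch. Qed.

Lemma gromov_cut p q s : 0 <= s <= height p ->
  gromov (cut p s) q = Num.min s (gromov p q).
Proof.
move=> /andP[s0 sp]; have s1 := le_trans sp (height_le1 p).
rewrite -{1}(branch_bits q) gromov_branch ?height_itv ?s0//.
by rewrite /gromov !minA (min_l sp).
Qed.

Lemma cut_gromov p q s : 0 <= s <= gromov p q -> cut p s = cut q s.
Proof.
move=> /andP[s0 spq]; have := gromov_lel p q; have := gromov_ler p q => mq mp.
have s1 : s <= 1 by rewrite (le_trans (le_trans spq mp))// height_le1.
apply: gromov_eq; rewrite gromov_branch ?s0// height_branch ?s0// !le_min !lexx/=;
  by rewrite (le_trans spq)// /gromov !ge_min lexx orbT.
Qed.

(* Every point of the arc [a, b] separates [a] from [b]. *)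
Lemma connected_cut (E : set D) a b s : connected E -> E a -> E b ->
  gromov a b <= s <= height b -> E (cut b s).
Proof.
move=> Ec Ea Eb /andP[abs]; rewrite le_eqVlt => /predU1P[->|sb].
  by rewrite cut_height.
have s0 : 0 <= s by rewrite (le_trans (gromov_ge0 a b)).
have s1 : s <= 1 by rewrite (le_trans (ltW sb))// height_le1.
have [//|Ep] := pselect (E (cut b s)).
(* If [E] misses the cut point, [U] (strictly above it towards [b]) and [W] (everything else) split
   [E] into two relatively open parts, the first containing [b] but not [a]. *)
pose U := [set q | s < gromov q b].
pose W := [set q | q <> cut b s /\ gromov q b <= s].
have oU : open U.
  apply: tree_open => q /= sq; exists (gromov q b - s); first by rewrite subr_gt0.
  by move=> q' qq'; have := gromov_lipschitz b q q'; rewrite /U/=; lra.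
have oW : open W.
  apply: tree_open => q -[qp]; rewrite le_eqVlt => /predU1P[qs|qs].
    have sq : s < height q.
      rewrite ltNge; apply/negP => qles; apply: qp; apply: gromov_eq; last first.
        by rewrite gromovC gromov_cut ?s0 ?(ltW sb)// height_cut ?s0// gromovC qs minxx.
      by rewrite gromovC gromov_cut ?s0 ?(ltW sb)// gromovC qs minxx.
    exists (height q - s) => [|q' qq']; first by rewrite subr_gt0.
    have sqq' : s < gromov q q' by have := tdist_ge_gromov q q'; lra.
    split.
      move=> e; move: sqq'; rewrite e gromovC gromov_cut ?s0 ?(ltW sb)//.
      by rewrite lt_min ltxx.
    rewrite leNgt; apply/negP => sq'b; have := gromov_trans q' q b.
    by rewrite qs leNgt => /negP; apply; rewrite lt_min sqq'.
  exists (s - gromov q b) => [|q' qq']; first by rewrite subr_gt0.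
  have sq'b : gromov q' b < s.
    by have := gromov_lipschitz b q' q; rewrite tdistC; lra.
  split; last exact: ltW.
  move=> e; move: sq'b; rewrite e gromov_cut ?s0 ?(ltW sb)// gromovxx.
  by rewrite (min_l (ltW sb)) ltxx.
have EU : E `&` U = E `&` ~` W.
  apply/seteqP; split=> q [Eq]; rewrite /U /W/= => H; split=> //.
    by case=> _; rewrite leNgt H.
  rewrite ltNge; apply/negP => qs; apply: H; split=> // qp.
  by apply: Ep; rewrite -qp.
have EUE : E `&` U = E.
  apply: Ec; first by exists b; split=> //; rewrite /U/= gromovxx.
    by exists U.
  by exists (~` W) => //; exact: open_closedC.
by have [_] : (E `&` U) a by [rewrite EUE]; rewrite /U/= ltNge abs.
Qed.

(** Both sets contain the arc from [a] to [b], hence an inner point of it. *)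
Lemma connected_meet (E F : set D) a b : connected E -> connected F ->
  E a -> E b -> F a -> F b -> a <> b ->
  exists c, [/\ E c, F c, c <> a & c <> b].
Proof.
move=> Ec Fc; wlog : a b / gromov a b < height b => [hwlog|ab].
  move=> Ea Eb Fa Fb ab; have [abb|bab] := ltP (gromov a b) (height b).
    exact: hwlog.
  have [aba|aab] := ltP (gromov a b) (height a); last by case: ab; exact: gromov_eq.
  have [||c [? ? ? ?]] := hwlog b a _ Eb Ea Fb Fa; first by rewrite gromovC.
    by move=> ba; exact: ab.
  by exists c.
(* Halfway between the meet and [b], which differ by the reduction just made. *)
move=> Ea Eb Fa Fb _; pose s := (gromov a b + height b) / 2.
have s0 : 0 <= s <= height b.
  by rewrite /s; have := gromov_ge0 a b => ?; apply/andP; split; lra.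
have s1 : gromov a b <= s <= height b by rewrite /s; apply/andP; split; lra.
exists (cut b s); split.
- exact: connected_cut Ea Eb _.
- exact: connected_cut Fa Fb _.
- move=> sa; have := gromov_cut b s0; rewrite sa gromovxx minEle.
  by have := gromovC; case: ifP; rewrite /s; lra.
- move/(congr1 (@height R)); rewrite height_cut; first by rewrite /s; lra.
  by case/andP: s0 => -> /le_trans; apply; exact: height_le1.
Qed.

(** The order of [s] and [t] is left free, so that the same path serves for climbing and for
    descending. *)
Definition cut_path p s t : set D :=
  (fun u => cut p (s + u * (t - s))) @` `[0%R : R, 1%R : R]%classic.

Lemma cut_path_itv s t u : 0 <= u <= 1 ->
  Num.min s t <= s + u * (t - s) <= Num.max s t.
Proof.
move=> /andP[u0 u1]; rewrite maxEle minEle.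
by case: ifP => [|/negbT]; rewrite -?ltNge => st; apply/andP; split; nra.
Qed.

Lemma cut_path_continuous p s t : continuous (fun u : R => cut p (s + u * (t - s))).
Proof.
move=> u; apply: continuous_comp; last exact: cut_continuous.
by apply: cvgD; [exact: cvg_cst|apply: cvgM; [exact: cvg_id|exact: cvg_cst]].
Qed.

Lemma cut_path_connected p s t : connected (cut_path p s t).
Proof.
apply: connected_continuous_connected.
  exact/connected_intervalP/interval_is_interval.
exact/continuous_subspaceT/cut_path_continuous.
Qed.

Lemma cut_path_start p s t : cut_path p s t (cut p s).
Proof. by exists 0; rewrite ?mul0r ?addr0//= in_itv/= lexx ler01. Qed.

Lemma cut_path_end p s t : cut_path p s t (cut p t).
Proof. by exists 1; rewrite ?mul1r ?subrKC//= in_itv/= lexx ler01. Qed.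

Lemma is_arc_cut_path p s t : 0 <= s <= height p -> 0 <= t <= height p -> s != t ->
  is_arc R (cut p s) (cut p t) (cut_path p s t).
Proof.
move=> /andP[s0 sp] /andP[t0 tp] st.
have hs u : 0 <= u <= 1 -> 0 <= s + u * (t - s) <= 1.
  move=> /(cut_path_itv s t) /andP[h1 h2]; apply/andP; split.
    by apply: le_trans h1; rewrite le_min s0.
  by apply: (le_trans h2); rewrite ge_max !(le_trans _ (height_le1 p)).
have ts : t - s != 0 by rewrite subr_eq0 eq_sym.
exists (fun u => cut p (s + u * (t - s))), (fun q => (height q - s) / (t - s)).
split; last 2 first.
- by rewrite mul0r addr0.
- by rewrite mul1r subrKC.
have K u : 0 <= u <= 1 -> (height (cut p (s + u * (t - s))) - s) / (t - s) = u.
  by move=> u1; rewrite height_cut ?hs// [s + _]addrC addrK mulfK.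
split.
- by move=> u u1; exists u.
- by move=> _ [u u1 <-]; move: u1; rewrite /= in_itv/= => u1; rewrite K.
- by move=> u; rewrite inE/= in_itv/=; exact: K.
- by move=> _ /set_mem[u u1 <-]; move: u1; rewrite /= in_itv/= => u1; rewrite K.
split; first exact/continuous_subspaceT/cut_path_continuous.
apply: continuous_subspaceT => q; apply: cvgM; last exact: cvg_cst.
by apply: cvgB; [exact: height_continuous|exact: cvg_cst].
Qed.

Definition segment p q : set D :=
  cut_path p (gromov p q) (height p) `|` cut_path q (gromov p q) (height q).

Lemma segment_connected p q : connected (segment p q).
Proof.
apply: connectedU; [|exact: cut_path_connected..].
exists (cut p (gromov p q)); split; first exact: cut_path_start.
rewrite (@cut_gromov p q) ?gromov_ge0 ?lexx//; exact: cut_path_start.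
Qed.

Lemma segment_left p q : segment p q p.
Proof. by left; have := cut_path_end p (gromov p q) (height p); rewrite cut_height. Qed.

Lemma segment_right p q : segment p q q.
Proof. by right; have := cut_path_end q (gromov p q) (height q); rewrite cut_height. Qed.

Lemma segment_dist p q r : segment p q r -> tdist p r <= tdist p q.
Proof.
have m0 := gromov_ge0 p q; have mp := gromov_lel p q; have mq := gromov_ler p q.
case=> -[u]; rewrite /= in_itv/= => u1 <-.
  have := cut_path_itv (gromov p q) (height p) u1; move: (_ + u * _) => v.
  rewrite (min_l mp) (max_r mp) => /andP[mv vp].
  rewrite /tdist gromovC gromov_cut ?vp ?(le_trans m0)// gromovxx (min_l vp).
  rewrite height_cut; first lra.
  by rewrite (le_trans m0 mv) (le_trans vp (height_le1 p)).
have := cut_path_itv (gromov p q) (height q) u1; move: (_ + u * _) => v.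
rewrite (min_l mq) (max_r mq) => /andP[mv vq].
rewrite /tdist gromovC gromov_cut ?vq ?(le_trans m0)// [gromov q p]gromovC (min_r mv).
rewrite height_cut; first lra.
by rewrite (le_trans m0 mv) (le_trans vq (height_le1 q)).
Qed.

Lemma star_connected (A : set D) p :
  A p -> (forall q, A q -> segment p q `<=` A) -> connected A.
Proof.
move=> Ap HA; rewrite (_ : A = \bigcup_(q in A) segment p q).
  apply: bigcup_connected => [|q _]; last exact: segment_connected.
  by exists p => q _; exact: segment_left.
apply/seteqP; split=> q; first by move=> Aq; exists q => //; exact: segment_right.
by move=> [r /HA]; apply.
Qed.

Lemma tree_connected : connected [set: D].
Proof. exact: (@star_connected _ (tree_root R)). Qed.

(** Open balls are star-shaped: by [segment_dist] the arc from the centre to a point of the ball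
    stays in the ball. *)
Lemma tree_locally_connected : locally_connected D.
Proof.
move=> p U /nbhs_ballP[e /= e0 eU]; exists [set q | tdist p q < e]; split.
- apply: tree_open => q /= pq; exists (e - tdist p q); first by rewrite subr_gt0.
  by move=> r qr; have := tdist_triangle q p r; lra.
- by rewrite /= tdistxx.
- apply: (@star_connected _ p) => [|q pq r /segment_dist]; first by rewrite /= tdistxx.
  by move=> pr; exact: le_lt_trans pq.
- by move=> q pq; apply: eU; rewrite tree_ball.
Qed.

(** The sign [e] treats the upper and lower closed half circles at once; each is the graph of a
    continuous function over [[-1, 1]]. *)
Lemma half_circle_connected (e : R) : e ^+ 2 = 1 ->
  connected [set z : R * R | z.1 ^+ 2 + z.2 ^+ 2 = 1 /\ 0 <= e * z.2].
Proof.
move=> e2; rewrite (_ : mkset _ =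
    (fun u => (u, e * Num.sqrt (1 - u ^+ 2))) @` `[-1%R : R, 1%R : R]%classic).
  apply: connected_continuous_connected.
    exact/connected_intervalP/interval_is_interval.
  apply: continuous_subspaceT => u.
  apply: (@cvg_pair _ _ _ _ (nbhs u) (nbhs (e * Num.sqrt (1 - u ^+ 2))));
    first exact: cvg_id.
  apply: cvgM; first exact: cvg_cst.
  apply: continuous_comp; last exact: sqrt_continuous.
  by apply: cvgB; [exact: cvg_cst|apply: exprn_continuous].
apply/seteqP; split=> [[u v]/= [uv ev]|_ [u /= + <-]].
  exists u; first by rewrite /= in_itv/=; apply/andP; split; nra.
  congr pair; rewrite (_ : 1 - _ = (e * v) ^+ 2); last by rewrite exprMn e2; lra.
  by rewrite sqrtr_sqr ger0_norm// mulrA -expr2 e2 mul1r.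
rewrite in_itv/= => /andP[u0 u1]; rewrite exprMn e2 mul1r sqr_sqrtr.
  split; first lra.
  by rewrite mulrA -expr2 e2 mul1r sqrtr_ge0.
by nra.
Qed.

(** The images of the two closed half circles both join [f a] to [f b], so [connected_meet] yields a
    third common point, whereas the half circles share only [a] and [b]. *)
Lemma tree_no_circle (C : set D) : ~ simple_closed_curve R C.
Proof.
move=> [f [g [fC gC fK gK [fc gc]]]].
pose a : R * R := (1, 0); pose b : R * R := (-1, 0).
have Sa : unit_circle a by rewrite /unit_circle/= expr1n expr0n addr0.
have Sb : unit_circle b by rewrite /unit_circle/= sqrrN expr1n expr0n addr0.
have gfK z : unit_circle z -> g (f z) = z by move=> /mem_set; exact: fK.
pose H e := [set z : R * R | z.1 ^+ 2 + z.2 ^+ 2 = 1 /\ 0 <= e * z.2].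
have Hc e : e ^+ 2 = 1 -> connected (f @` H e).
  move=> e2; apply: connected_continuous_connected.
    exact: half_circle_connected.
  by apply: continuous_subspaceW fc => z [].
have Ha e : (f @` H e) (f a) by exists a; rewrite // /H/= mulr0.
have Hb e : (f @` H e) (f b) by exists b; rewrite // /H/= mulr0.
have fab : f a <> f b.
  move=> /(congr1 g); rewrite !gfK// => -[] /eqP; rewrite -addr_eq0.
  by rewrite -[1 + 1]/(2%:R) pnatr_eq0.
have [||_ [[z [z1 z2] <-] [z' [z1' z2'] zz'] fza fzb]] :=
  @connected_meet (f @` H 1) (f @` H (-1)) _ _ _ _ (Ha _) (Hb _) (Ha _) (Hb _) fab.
- by apply: Hc; rewrite expr1n.
- by apply: Hc; rewrite sqrrN expr1n.
have e : z' = z by rewrite -(gfK z')// zz' gfK.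
have z20 : z.2 = 0 by rewrite {}e in z2'; lra.
move: z1; rewrite z20 expr0n addr0 => /eqP; rewrite sqrf_eq1 => /orP[] /eqP z11.
  by apply: fza; congr f; rewrite [z]surjective_pairing z20 z11.
by apply: fzb; congr f; rewrite [z]surjective_pairing z20 z11.
Qed.

End tree_topology.

(** * Orders of points *)

Lemma is_arc_connected (R : realType) (T : topologicalType) (a b : T) (A : set T) :
  is_arc R a b A -> [/\ connected A, A a, A b & a <> b].
Proof.
move=> [f [g [[fA gA fK gK [fc _]] <- <-]]].
have I0 : `[0%R : R, 1%R : R]%classic 0 by rewrite /= in_itv/= lexx ler01.
have I1 : `[0%R : R, 1%R : R]%classic 1 by rewrite /= in_itv/= lexx ler01.
split; [|exact: fA|exact: fA|].
  rewrite (_ : A = f @` `[0%R : R, 1%R : R]%classic).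
    apply: connected_continuous_connected fc.
    exact/connected_intervalP/interval_is_interval.
  apply/seteqP; split=> [x Ax|_ [u uI <-]]; last exact: fA.
  by exists (g x); [exact: gA|apply: gK; exact/mem_set].
move=> /(congr1 g); rewrite !fK ?inE// => /eqP.
by rewrite eq_sym oner_eq0.
Qed.

Section star_of_arcs.
Context (T : topologicalType) (R : realType).

Lemma star_of_arcs1 (v b : T) (A : set T) : is_arc R v b A -> star_of_arcs R v 1.
Proof.
by move=> vA; exists (fun=> b), (fun=> A); split=> // i j; rewrite !ord1 eqxx.
Qed.

Lemma star_of_arcs2 (v b c : T) (A B : set T) :
  is_arc R v b A -> is_arc R v c B -> A `&` B = [set v] -> star_of_arcs R v 2.
Proof.
move=> vA vB AB; exists (fun i => if i == ord0 then b else c).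
exists (fun i => if i == ord0 then A else B); split=> [i|i j]; first by case: ifP.
by case: (unliftP ord0 i) => [i'|] ->; case: (unliftP ord0 j) => [j'|] ->;
  rewrite ?ord1 ?eqxx// => _; rewrite setIC.
Qed.

Lemma le_point_order (v : T) n : star_of_arcs R v n -> (n%:R%:E <= point_order R v)%E.
Proof. by move=> vn; apply: ereal_sup_ubound; exists n. Qed.

Lemma point_order_le (v : T) n : (forall k, star_of_arcs R v k -> (k <= n)%N) ->
  (point_order R v <= n%:R%:E)%E.
Proof.
by move=> vn; apply: ge_ereal_sup => _ [k /vn kn <-]; rewrite lee_fin ler_nat.
Qed.

End star_of_arcs.

Section tree_order.
Context (R : realType).
Local Notation D := (tree R).
Implicit Types (p q v : D) (s t : R).

(** Index of the first fork at or above [v]. At height 1 there is none, and 0 is a default value. *)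
Definition fork v : nat :=
  if pselect (exists n, height v <= level R n) is left e then ex_minn e else 0.

Lemma forkP v : height v < 1 ->
  height v <= level R (fork v) /\
  forall i, (i < fork v)%N -> level R i < height v.
Proof.
move=> /level_unbounded[n /ltW vn]; rewrite /fork.
case: pselect => [e|[]]; last by exists n.
case: ex_minnP => m vm mmin; split=> // i im; rewrite ltNge; apply/negP => /mmin.
by rewrite leqNgt im.
Qed.

(* [None] is the direction from [v] towards the root, [Some b] the direction of
   the branches above [v] that read the bit [b] at the next fork. *)
Definition direction v q : option bool :=
  if gromov v q < height v then None else Some (bits q (fork v)).

Lemma direction_meet (E F : set D) v p q : connected E -> connected F ->
  E v -> E p -> v <> p -> F v -> F q -> v <> q ->
  direction v p = direction v q -> exists2 c, E c /\ F c & c <> v.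
Proof.
move=> Ec Fc Ev Ep vp Fv Fq vq; have v0 := height_ge0 v; have v1 := height_le1 v.
rewrite /direction; case: ltP => vpv; case: ltP => vqv //.
  (* Both points lie towards the root: the higher of the two meets is still below [v] and belongs to
     both arcs. *)
  move=> _; pose s := Num.max (gromov v p) (gromov v q).
  have sv : s < height v by rewrite gt_max vpv.
  have s0 : 0 <= s by rewrite le_max gromov_ge0.
  exists (cut v s).
    split; [apply: (connected_cut Ec Ep Ev)|apply: (connected_cut Fc Fq Fv)];
      by rewrite [gromov _ v]gromovC le_max lexx ?orbT (ltW sv).
  move/(congr1 (@height R)); rewrite height_cut; first by move=> e; rewrite e ltxx in sv.
  by rewrite s0 (le_trans (ltW sv)).
have above r : v <> r -> height v <= gromov v r -> height v < height r.
  move=> vr vrv; rewrite ltNge; apply/negP => rv; apply: vr; apply: gromov_eq => //.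
  exact: le_trans rv vrv.
have {vp}vp := above _ vp vpv; have {vq}vq := above _ vq vqv.
move=> [pq]; have [vn ni] := forkP (lt_le_trans vp (height_le1 p)).
(* Both points lie above [v] and share the bits up to index [fork v] included, so their paths
   coincide up to the next fork or the lower of the two points. *)
pose s := Num.min (Num.min (height p) (height q)) (level R (fork v).+1).
have vs : height v < s.
  by rewrite !lt_min vp vq (le_lt_trans vn)// level_lt.
have spq : s <= gromov p q.
  apply/le_gromovP; split; rewrite ?ge_min ?lexx ?orbT// => i.
  rewrite !lt_min level_lt ltnS leq_eqVlt => /andP[_ /predU1P[->//|/ni iv]].
  have /le_gromovP[_ _ <-//] := vpv; have /le_gromovP[_ _ <-//] := vqv.
exists (cut p s).
  split; last rewrite (@cut_gromov _ p q s) ?spq ?(le_trans v0 (ltW vs))//.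
    apply: connected_cut Ev Ep _ => //.
    by rewrite (le_trans (gromov_lel v p) (ltW vs)) (le_trans spq (gromov_lel p q)).
  apply: connected_cut Fv Fq _ => //.
  by rewrite (le_trans (gromov_lel v q) (ltW vs)) (le_trans spq (gromov_ler p q)).
move/(congr1 (@height R)); rewrite height_cut; first by move=> e; rewrite e ltxx in vs.
rewrite (le_trans v0 (ltW vs)) (le_trans spq)// (le_trans (gromov_lel p q))//.
exact: height_le1.
Qed.

(** Arcs of a star meet only at [v], while equal directions would force a further common point.
    Counting directions thus bounds the order. *)
Lemma star_direction v n (b : 'I_n -> D) (A : 'I_n -> set D) :
  (forall i, is_arc R v (b i) (A i)) ->
  (forall i j, i != j -> A i `&` A j = [set v]) ->
  injective (fun i => direction v (b i)).
Proof.
move=> vA AA i j /= dij; have [//|/AA Aij] := eqVneq i j.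
have [Aic Aiv Aib vbi] := is_arc_connected (vA i).
have [Ajc Ajv Ajb vbj] := is_arc_connected (vA j).
have [c Ac cv] := direction_meet Aic Ajc Aiv Aib vbi Ajv Ajb vbj dij.
by have : (A i `&` A j) c by []; rewrite Aij.
Qed.

Lemma point_order_le3 v : (point_order R v <= 3%:R%:E)%E.
Proof.
apply: point_order_le => n [b [A [vA AA]]].
have := leq_card _ (star_direction vA AA).
by rewrite card_ord card_option card_bool.
Qed.

Lemma point_order_top v : height v = 1 -> point_order R v = 1%:E.
Proof.
move=> v1; apply/le_anti/andP; split.
  apply: (@point_order_le _ _ _ 1) => n [b [A [vA AA]]].
  rewrite leqNgt; apply/negP => n1; have n0 := ltnW n1.
  (* Nothing lies above a point of height 1, so every arc leaves it towards the root. *)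
  have dN i : direction v (b i) = None.
    rewrite /direction; case: ltP => // vb.
    have [_ _ _] := is_arc_connected (vA i); case; apply: gromov_eq => //.
    by rewrite (le_trans (height_le1 _))// -v1.
  have /(congr1 val) := star_direction vA AA
    (etrans (dN (Ordinal n0)) (esym (dN (Ordinal n1)))).
  by [].
apply: (@le_point_order _ _ _ 1); apply: (@star_of_arcs1 _ _ _ (cut v 0)).
rewrite -{1}(cut_height v); apply: is_arc_cut_path; rewrite ?lexx ?height_ge0//.
by rewrite v1 oner_eq0.
Qed.

Lemma point_order_lt1 v : height v < 1 -> (2%:R%:E <= point_order R v)%E.
Proof.
move=> v1; apply: le_point_order; have v0 := height_ge0 v.
have h1 x : height (branch x 1 : D) = 1 by rewrite height_branch// ler01 lexx.
have : 0 <= height v by []; rewrite le_eqVlt => /predU1P[vz|vp].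
  (* At the root, which sits on fork 0, the two arcs climb along the constant branches. *)
  pose w b : D := branch (fun=> b) 1.
  have wv b : cut (w b) 0 = v.
    apply: tree_ext => /=; first by rewrite clamp_id ?lexx ?ler01// vz.
    move=> n; rewrite /= [clamp 0]clamp_id ?lexx ?ler01//.
    rewrite [X in _ && X]ltNge level_ge0 andbF.
    by rewrite bits_false// -vz level_ge0.
  have arcw b : is_arc R v (cut (w b) 1) (cut_path (w b) 0 1).
    rewrite -{1}(wv b); apply: is_arc_cut_path; rewrite ?h1 ?lexx ?ler01//.
    by rewrite eq_sym oner_eq0.
  apply: (star_of_arcs2 (arcw true) (arcw false)).
  apply/seteqP; split=> [p|_ ->]; last first.
    by split; [rewrite -(wv true)|rewrite -(wv false)]; exact: cut_path_start.
  move=> [[s /= s1 <-] [t t1]]; rewrite !subr0 !mulr1 !add0r => e.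
  move: s1 t1; rewrite /= !in_itv/= => s1 t1.
  have st : t = s by move/(congr1 (@height R)): e; rewrite !height_cut.
  move: s1 => /andP[]; rewrite le_eqVlt => /predU1P[<- _|s0 s1]; first exact: wv.
  have /(congr1 (fun p => bits p 0)) := e.
  by rewrite /= !clamp_id ?s1 ?st ?(ltW s0) ?ler01 ?lexx// level_0 s0 ltr01.
(* Above the root, one arc climbs along the padded branch through [v] and the other descends to the
   root. *)
pose w : D := branch (bits v) 1.
have mvw : gromov v w = height v.
  rewrite -{1}(branch_bits v) gromov_branch ?height_itv ?ler01 ?lexx//.
  by rewrite agreexx (min_l (ltW v1)) (min_l (ltW v1)).
have wv : cut w (height v) = v.
  by rewrite -[RHS]cut_height (@cut_gromov _ w v)// gromovC mvw v0 lexx.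
have up : is_arc R v (cut w 1) (cut_path w (height v) 1).
  by rewrite -{1}wv; apply: is_arc_cut_path; rewrite ?h1 ?v0 ?lexx ?ler01 ?ltW ?lt_eqF.
have down : is_arc R v (cut v 0) (cut_path v (height v) 0).
  rewrite -{1}(cut_height v).
  by apply: is_arc_cut_path; rewrite ?v0 ?lexx ?gt_eqF.
apply: (star_of_arcs2 up down); apply/seteqP; split=> [p|_ ->]; last first.
  split; first by have := cut_path_start w (height v) 1; rewrite wv.
  by have := cut_path_start v (height v) 0; rewrite cut_height.
move=> [[s /= s1 <-] [t t1]]; move: s1 t1; rewrite /= !in_itv/=.
move=> /(cut_path_itv (height v) 1); rewrite (min_l (ltW v1)) (max_r (ltW v1)).
move: (_ + s * _) => {}s /andP[vs s1].
move=> /(cut_path_itv (height v) 0); rewrite (min_r v0) (max_l v0).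
move: (_ + t * _) => {}t /andP[t0 tv] e.
have st : t = s.
  move/(congr1 (@height R)): e; rewrite !height_cut ?t0 ?(le_trans v0 vs)//.
  exact: le_trans tv (ltW v1).
by rewrite -e (_ : t = height v) ?cut_height//; apply/le_anti; rewrite tv st.
Qed.

Lemma endpoints_tree : @endpoints R D = [set v | height v = 1].
Proof.
apply/seteqP; split=> v; last exact: point_order_top.
rewrite /endpoints/= => ov; apply/eqP; rewrite eq_le height_le1/= leNgt.
by apply/negP => /point_order_lt1; rewrite ov lee_fin lern1.
Qed.

Lemma bits_continuous v : height v = 1 ->
  {for v, continuous (@bits R : D -> cantor_space)}.
Proof.
move=> v1; apply: prod_topology_cvg => n B /nbhs_singleton Bv.
(* At height 1, closeness below [1 - level n] puts the product above [level n], which fixes bit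
   [n]. *)
have e0 : 0 < 1 - level R n by rewrite subr_gt0 level_lt1.
apply: filterS (near_tree v e0) => q vq /=.
rewrite (_ : bits q n = bits v n)//; apply/esym.
have /le_gromovP[_ _] := lexx (gromov v q); apply.
by have := tdist_ge_gromov v q; lra.
Qed.

Lemma branch1_continuous : continuous (fun x : cantor_space => branch x 1 : D).
Proof.
move=> x; apply: (@continuous_comp _ _ _ (fun x : cantor_space => (x, 1 : R))
  (fun z : cantor_space * R => branch z.1 z.2 : D)).
  by apply: (@cvg_pair _ _ _ _ (nbhs x) (nbhs (1 : R))); [exact: cvg_id|exact: cvg_cst].
exact: branch_continuous.
Qed.

Lemma bits_branch1 x : bits (branch x 1 : D) = x.
Proof.
apply/funext => n /=; rewrite clamp_id ?lexx ?ler01//.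
by rewrite level_lt1 andbT.
Qed.

Lemma endpoints_cantor : homeomorphic (@endpoints R D) [set: cantor_space].
Proof.
rewrite endpoints_tree; exists (@bits R), (fun x => branch x 1); split.
- by [].
- by move=> x _; rewrite /= clamp_id// ler01 lexx.
- by move=> v; rewrite inE/= => v1; rewrite -{2}(branch_bits v) v1.
- by move=> x _; exact: bits_branch1.
split; last exact/continuous_subspaceT/branch1_continuous.
apply/subspace_continuousP => v v1; apply: cvg_within_filter.
exact: bits_continuous.
Qed.

Lemma gehman_tree : gehman_dendrite D.
Proof.
split; last by move=> v v3; apply/le_anti; rewrite point_order_le3.
  split; [exact: tree_compact|exact: tree_connected
    |exact: tree_locally_connected|exact: tree_no_circle].
exact: endpoints_cantor.
Qed.

End tree_order.

(** * Extension of a subshift to the tree *)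

Section shift_retraction.
Context (R : realType) (k : nat) (W : set (nat -> bool)).
Hypothesis W0 : W !=set0.
Hypothesis k0 : (0 < k)%N.
Local Notation D := (tree R).
Implicit Types (p q : D) (x y : nat -> bool) (s t : R).

(* The height at which the branch [x] leaves the subtree spanned by [W]. *)
Definition exit x : R := sup [set agree R x y | y in W].

Let exit_has_sup x : has_sup [set agree R x y | y in W].
Proof.
split; first by case: W0 => y Wy; exists (agree R x y), y.
by exists 1 => _ [y _ <-]; exact: agree_le1.
Qed.

Lemma agree_le_exit x y : W y -> agree R x y <= exit x.
Proof. by move=> Wy; apply: (sup_upper_bound (exit_has_sup x)); exists y. Qed.

Lemma exit_le x s : (forall y, W y -> agree R x y <= s) -> exit x <= s.
Proof.
by move=> xs; apply: ge_sup => [|_ [y Wy <-]]; [case: (exit_has_sup x)|exact: xs].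
Qed.

Lemma exit_le1 x : exit x <= 1.
Proof. by apply: exit_le => y _; exact: agree_le1. Qed.

Lemma exit1 x : W x -> exit x = 1.
Proof.
move=> /(agree_le_exit x); rewrite agreexx => x1.
by apply/le_anti; rewrite exit_le1.
Qed.

(** Applied in both directions, this says that the exits of two branches are equal or both at least
    as high as their separation. *)
Lemma exit_agree x y : Num.min (agree R x y) (exit x) <= exit y.
Proof.
have [xy|xy] := leP (agree R x y) (exit y); first by rewrite ge_min xy.
rewrite ge_min; apply/orP; right; apply: exit_le => z Wz.
have := agree_le_exit y Wz; have := agree_trans R x y z.
by rewrite agreeC minEle; case: ifP; lra.
Qed.

(** Expands the distance to the top by [2 ^+ k], sending [level (n + k)] to [level n]; heights that
    would become negative go to the root. *)
Definition lower t : R := Num.max 0 (1 - 2 ^+ k * (1 - t)).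

Lemma lower_ge0 t : 0 <= lower t.
Proof. by rewrite /lower le_max lexx. Qed.

Let pow_gt0 : 0 < 2 ^+ k :> R. Proof. by rewrite exprn_gt0. Qed.

Lemma lower_le1 t : t <= 1 -> lower t <= 1.
Proof. by move=> t1; rewrite /lower ge_max ler01/=; have := pow_gt0; nra. Qed.

Lemma lower1 : lower 1 = 1.
Proof. by rewrite /lower subrr mulr0 subr0 max_r. Qed.

Lemma lower_homo s t : s <= t -> lower s <= lower t.
Proof.
move=> st; rewrite /lower ge_max !le_max lexx/=; apply/orP; right.
by have := pow_gt0; nra.
Qed.

Lemma lower_lipschitz s t : s <= t -> lower t - lower s <= 2 ^+ k * (t - s).
Proof.
move=> st; have := pow_gt0; rewrite /lower !maxEle.
by case: ifPn; case: ifPn; rewrite -?ltNge => *; nra.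
Qed.

Lemma lower_lt1 t : t < 1 -> lower t < 1.
Proof. by move=> t1; rewrite /lower gt_max ltr01/=; have := pow_gt0; nra. Qed.

(** Since [0 < k], each step descends at least one level; this brings every point of height below 1
    to the root in finitely many steps. *)
Lemma lower_level n t : t <= level R n.+1 -> lower t <= level R n.
Proof.
move=> tn; rewrite /lower ge_max level_ge0/= /level.
have k2 : 2 <= 2 ^+ k :> R by rewrite -[leLHS]expr1 ler_eXn2l// ltr1n.
move: tn; rewrite /level exprS; have : 0 < 2^-1 ^+ n :> R by rewrite exprn_gt0.
by move: (2^-1 ^+ n) => u u0 tn; nra.
Qed.

Lemma lower0 : lower 0 = 0.
Proof.
apply/le_anti; rewrite lower_ge0 andbT -[leRHS](level_0 R).
by apply: lower_level; exact: level_ge0.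
Qed.

Definition bshift x : nat -> bool := fun n => x (n + k)%N.

Lemma agree_bshift x y : lower (agree R x y) <= agree R (bshift x) (bshift y).
Proof.
apply/le_agreeP; first exact/lower_le1/agree_le1.
(* Above [level n] the maximum in [lower] is its affine part, and undoing it turns [level n] into
   [level (n + k)]. *)
move=> n; rewrite lt_max ltNge level_ge0/= => nxy; apply: (@agree_eq R x y (n + k)).
rewrite /level exprD; rewrite /level in nxy.
have kk : 2^-1 ^+ k * 2 ^+ k = 1 :> R by rewrite -exprMn mulVf ?expr1n.
have k1 : 0 < 2^-1 ^+ k :> R by rewrite exprn_gt0.
move: nxy; move: (agree R x y) (2^-1 ^+ n) (2^-1 ^+ k) (2 ^+ k) kk k1 => a u v w.
move=> vw v0 ua; have : 0 < v * (u - w * (1 - a)) by rewrite mulr_gt0//; lra.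
by rewrite mulrBr mulrA vw mul1r; lra.
Qed.

(* Retract to the subtree spanned by [W], then shift [k] levels down. *)
Definition tree_map p : D :=
  branch (bshift (bits p)) (lower (Num.min (height p) (exit (bits p)))).

Lemma height_tree_map p :
  height (tree_map p) = lower (Num.min (height p) (exit (bits p))).
Proof.
by rewrite height_branch// lower_ge0 lower_le1// ge_min height_le1.
Qed.

(** Here [a], [b] are heights, [c], [d] exits and [m] the separation of the branches. Either the
    meet lies in the subtree and is kept, or the exits coincide below it and both points retract to
    the same point. *)
Lemma retraction_nonexpansive (a b m c d : R) :
  Num.min m c <= d -> Num.min m d <= c ->
  Num.min a c + Num.min b d - 2 * Num.min (Num.min (Num.min a c) (Num.min b d)) m
  <= a + b - 2 * Num.min (Num.min a b) m.
Proof.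
move=> mcd mdc; move nE : (Num.min (Num.min a b) m) => n.
have na : n <= a by rewrite -nE !ge_min lexx.
have nb : n <= b by rewrite -nE !ge_min lexx orbT.
have nm : n <= m by rewrite -nE !ge_min lexx !orbT.
have [/andP[nc nd]|] := boolP ((n <= c) && (n <= d)).
  have h : n <= Num.min (Num.min (Num.min a c) (Num.min b d)) m.
    by rewrite !le_min na nb nm nc nd.
  have ha : Num.min a c <= a by rewrite ge_min lexx.
  have hb : Num.min b d <= b by rewrite ge_min lexx.
  lra.
rewrite negb_and -!ltNge => cdn.
have cd : c = d.
  apply/le_anti/andP; split; [move: mcd|move: mdc];
    rewrite ge_min => /orP[] // md; case/orP: cdn => h; lra.
rewrite -cd in cdn *; have {cdn}cn : c < n by case/orP: cdn.
rewrite (min_r (ltW (lt_le_trans cn na))) (min_r (ltW (lt_le_trans cn nb))).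
by rewrite minxx (min_l (ltW (lt_le_trans cn nm))); lra.
Qed.

Lemma tree_map_lipschitz p q :
  tdist (tree_map p) (tree_map q) <= 2 ^+ k * tdist p q.
Proof.
have := retraction_nonexpansive (height p) (height q)
  (exit_agree (bits p) (bits q)).
have := exit_agree (bits q) (bits p); rewrite agreeC => /[swap]/[apply].
rewrite -/(gromov p q) -/(tdist p q) => le_pq.
apply: le_trans (ler_wpM2l (ltW pow_gt0) le_pq).
have l1 r : 0 <= lower (Num.min (height r) (exit (bits r))) <= 1.
  by rewrite lower_ge0 lower_le1// ge_min height_le1.
rewrite branch_dist//.
have := agree_bshift (bits p) (bits q); move: (agree _ (bits p) (bits q)) => m.
move: (Num.min (height p) _) (Num.min (height q) _) => s t mpq.
(* [n] is the product of the retracted points, and [lower n] bounds the product of their images from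
   below. *)
pose n := Num.min (Num.min s t) m; rewrite -/n.
have ns : n <= s by rewrite /n !ge_min lexx.
have nt : n <= t by rewrite /n !ge_min lexx orbT.
have : lower n <= Num.min (Num.min (lower s) (lower t))
    (agree R (bshift (bits p)) (bshift (bits q))).
  rewrite !le_min !lower_homo//=; apply: le_trans mpq.
  by apply: lower_homo; rewrite /n !ge_min lexx !orbT.
by have := lower_lipschitz ns; have := lower_lipschitz nt; lra.
Qed.

Lemma tree_map_continuous : continuous tree_map.
Proof.
apply/continuous_treeP => p e e0.
have e'0 : 0 < e / 2 ^+ k by rewrite divr_gt0.
apply: filterS (near_tree p e'0) => q pq.
by rewrite (le_lt_trans (tree_map_lipschitz p q))// mulrC -ltr_pdivlMr.
Qed.

Lemma height_le0 p : height p <= 0 -> p = tree_root R.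
Proof.
move=> p0; apply: gromov_eq; first exact: le_trans p0 (gromov_ge0 _ _).
by rewrite height_branch ?gromov_ge0// lexx ler01.
Qed.

Lemma iter_tree_map_root n p : height p <= level R n -> iter n tree_map p = tree_root R.
Proof.
elim: n p => [|n IHn] p; first by rewrite level_0 => /height_le0.
move=> pn; rewrite iterSr; apply: IHn; rewrite height_tree_map; apply: lower_level.
by rewrite ge_min pn.
Qed.

Lemma tree_map_root : tree_map (tree_root R) = tree_root R.
Proof.
apply: height_le0; rewrite height_tree_map -lower0 lower_homo//.
by rewrite ge_min height_branch ?lexx ?ler01.
Qed.

Lemma tree_map_eventually_root p : exit (bits p) < 1 \/ height p < 1 ->
  exists n, iter n tree_map p = tree_root R.
Proof.
move=> p1; have : height (tree_map p) < 1.
  by rewrite height_tree_map lower_lt1// gt_min; case: p1 => ->; rewrite ?orbT.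
move=> /level_unbounded[n /ltW /iter_tree_map_root pn].
by exists n.+1; rewrite iterSr.
Qed.

Lemma tree_map_branch1 x : W x -> tree_map (branch x 1) = branch (bshift x) 1.
Proof.
move=> Wx; rewrite /tree_map bits_branch1 exit1// height_branch ?lexx ?ler01//.
by rewrite minxx lower1.
Qed.

End shift_retraction.

(** * Binary coding of a subshift as a closed set of endpoints *)

Section subshift_embedding.
Context (R : realType) (A : finType) (V : subshift A).
Local Notation D := (tree R).

Lemma full_shift_compact : compact [set: full_shift A].
Proof.
have Ac (n : nat) : compact [set: discrete_topology A].
  by apply: finite_compact; exact: finite_finset.
have := @tychonoff _ (fun _ : nat => discrete_topology A) _ Ac.
by congr (compact _); rewrite eqEsubset.
Qed.

Lemma set_type_compact (T : topologicalType) (B : set T) :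
  compact B -> compact [set: set_type B].
Proof.
move=> Bc F FF _; have [|x [Bx xF]] := Bc ((@set_val _ B) @ F) (fmap_proper_filter _ FF).
  by apply: (@filterS _ F _ _ _ _ filterT) => y _; exact: set_valP.
exists (SigSub (mem_set Bx)); split=> // C E FC.
rewrite nbhsE => -[_ [[E' oE' <-] E'x] sE].
have [|_ [[y Cy <-] E'y]] := xF (@set_val _ B @` C) E' _ (open_nbhs_nbhs (conj oE' E'x)).
  by apply: (@filterS _ F _ _ _ _ FC) => y Cy; exists y.
by exists y; split=> //; apply: sE.
Qed.

Lemma subshift_compact : compact [set: subshift_space V].
Proof.
apply: set_type_compact; apply: subclosed_compact full_shift_compact _ => //.
exact: subshift_closed.
Qed.

Let a0 : A := set_val (point : subshift_space V) 0%N.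

Let cardA_gt0 : (0 < #|A|)%N. Proof. by apply/card_gt0P; exists a0. Qed.

(* Each letter is written as its indicator, a block of [#|A|] bits. *)
Definition onehot (v : full_shift A) : nat -> bool :=
  fun m => v (m %/ #|A|)%N == nth a0 (enum A) (m %% #|A|)%N.

Lemma onehot_shift v : onehot (shift_map v) = bshift #|A| (onehot v).
Proof.
apply/funext => m; rewrite /onehot /bshift /shift_map modnDr.
by rewrite divnDr ?dvdnn// divnn cardA_gt0 addn1.
Qed.

Lemma onehot_inj : injective onehot.
Proof.
(* Bit [j] of block [n] is set for [v], hence for [w], and it identifies the letter. *)
move=> v w vw; apply/funext => n; pose j := index (v n) (enum A).
have jA : (j < #|A|)%N by rewrite cardE index_mem mem_enum.
have /(congr1 (fun x => x (n * #|A| + j)%N)) := vw.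
rewrite /onehot divnMDl// modnMDl (divn_small jA) (modn_small jA) addn0.
by rewrite nth_index ?mem_enum// eqxx => /esym/eqP.
Qed.

Lemma onehot_continuous : continuous (onehot : full_shift A -> cantor_space).
Proof.
move=> v; have vF : Filter (nbhs v) by exact: nbhs_filter.
apply: (@prod_topology_cvg nat (fun=> bool) (onehot @ nbhs v)) => m B mB.
have Bv : B (onehot v m) := nbhs_singleton mB.
have := @coord_continuous _ (fun=> discrete_topology A) (m %/ #|A|)%N v.
move=> /(_ [set v (m %/ #|A|)%N] (discrete_set1 _)).
apply: (@filterS _ (nbhs v) vF) => w /= wv.
by rewrite /onehot wv.
Qed.

Definition embed (v : subshift_space V) : D := branch (onehot (set_val v)) 1.

Lemma embed_continuous : continuous embed.
Proof.
move=> v; apply: (@continuous_comp _ _ _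
  (fun v : subshift_space V => onehot (set_val v) : cantor_space)
  (fun x => branch x 1 : D)); last exact: branch1_continuous.
apply: (@continuous_comp _ _ _
  (fun v : subshift_space V => set_val v : full_shift A)).
  exact: initial_continuous.
exact: onehot_continuous.
Qed.

Lemma embed_inj : injective embed.
Proof.
move=> v w /(congr1 (@bits R)); rewrite !bits_branch1 => /onehot_inj.
exact: val_inj.
Qed.

Lemma embed_closed : closed (range embed).
Proof.
apply: compact_closed; first exact: metric_hausdorff.
apply: continuous_compact subshift_compact.
exact/continuous_subspaceT/embed_continuous.
Qed.

Definition codes : set (nat -> bool) :=
  range (fun v : subshift_space V => onehot (set_val v)).

Lemma codes_neq0 : codes !=set0.
Proof. by exists (onehot (set_val (point : subshift_space V))), point. Qed.

(** A supremum equal to 1 need not be attained, so closedness of the embedded subshift is used: a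
    ball around the endpoint of [x] misses it, and endpoints are at distance [2 * (1 - agree)]. *)
Lemma exit_codes x : ~ codes x -> exit R codes x < 1.
Proof.
move=> nx; have : ~ range embed (branch x 1 : D).
  move=> [v _ /(congr1 (@bits R))]; rewrite !bits_branch1 => vx.
  by apply: nx; exists v.
have /closed_openC := embed_closed; rewrite openE => oE /oE /nbhs_ballP[e /= e0 He].
apply: (@le_lt_trans _ _ (1 - e / 2)); last by lra.
apply: exit_le codes_neq0 _ _ _ => _ [v _ <-]; rewrite leNgt; apply/negP => ve.
apply: (He (embed v)); last by exists v.
rewrite tree_ball/= branch_dist ?ler01 ?lexx// minxx min_r ?agree_le1//.
by lra.
Qed.

Definition shift_tree : D -> D := tree_map #|A| codes.

Lemma shift_tree_continuous : continuous shift_tree.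
Proof. exact/tree_map_continuous/codes_neq0. Qed.

Lemma shift_tree_root : shift_tree (tree_root R) = tree_root R.
Proof. exact: tree_map_root cardA_gt0. Qed.

Lemma embed_shift v : embed (subshift_map v) = shift_tree (embed v).
Proof.
rewrite /shift_tree tree_map_branch1; [|exact: codes_neq0|by exists v].
by rewrite -onehot_shift.
Qed.

Lemma shift_tree_eventually_root p : ~ range embed p ->
  exists n, iter n shift_tree p = tree_root R.
Proof.
move=> np; apply: (tree_map_eventually_root cardA_gt0).
have := height_le1 p; rewrite le_eqVlt => /predU1P[p1|]; last by right.
left; apply: exit_codes => -[v _ vp]; apply: np; exists v => //.
by rewrite /embed vp -p1 branch_bits.
Qed.

Lemma root_notin_embed : ~ range embed (tree_root R).
Proof.
move=> [v _ /(congr1 (@height R))]; rewrite !height_branch ?lexx ?ler01//.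
by move/eqP; rewrite oner_eq0.
Qed.

End subshift_embedding.

(** * Existence of invariant measures *)

Lemma ultra_cvg (T : Type) (X : topologicalType) (U : set_system T) (a : T -> X)
    (K : set X) : UltraFilter U -> compact K -> (forall t, K (a t)) ->
  exists2 l, K l & a @ U --> l.
Proof.
move=> UU Kc Ka; have UP : ProperFilter U by exact: ultra_proper.
have [|l [Kl al]] := Kc (a @ U) (fmap_proper_filter a UP).
  by apply: (@filterS _ U _ _ _ _ filterT) => t _; exact: Ka.
exists l => // B lB; have [//|aB] := in_ultra_setVsetC (a @^-1` B) UU.
have [x [nBx Bx]] := al (~` B) B aB lB.
by have := nBx Bx.
Qed.

Section invariant_mean.
Context (R : realType).
Implicit Types (S : set nat) (N : nat).

Definition frequency S N : R := (\sum_(i < N) (nat_of_bool `[< S i >])%:R) / N%:R.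

Lemma frequency_itv S N : `[0%R : R, 1%R : R]%classic (frequency S N).
Proof.
rewrite /= in_itv/= /frequency; apply/andP; split.
  by rewrite divr_ge0// sumr_ge0.
have [->|N0] := eqVneq N 0%N; first by rewrite invr0 mulr0 ler01.
rewrite ler_pdivrMr ?ltr0n ?lt0n// mul1r.
rewrite -[X in _ <= X%:R]card_ord -sum1_card natr_sum; apply: ler_sum => i _.
by case: asboolP.
Qed.

Lemma frequencyT N : (0 < N)%N -> frequency setT N = 1.
Proof.
move=> N0; rewrite /frequency (eq_bigr (fun=> 1)).
  by rewrite sumr_const card_ord divff// pnatr_eq0 -lt0n.
by move=> i _; rewrite asboolT.
Qed.

Lemma frequencyU S S' N : S `&` S' = set0 ->
  frequency (S `|` S') N = frequency S N + frequency S' N.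
Proof.
move=> SS'; rewrite /frequency -mulrDl -big_split/=; congr (_ / _).
apply: eq_bigr => i _; case: asboolP => [[Si|Si]|/not_orP[Si S'i]].
- rewrite (asboolT Si) asboolF ?addr0// => S'i.
  by have : (S `&` S') i by []; rewrite SS'.
- rewrite (asboolT Si) asboolF ?add0r// => S'i.
  by have : (S `&` S') i by []; rewrite SS'.
- by rewrite !asboolF// addr0.
Qed.

(** The difference of the two sums telescopes to two boundary terms in [[0, 1]]. *)
Lemma frequency_succ S N :
  `|frequency (succn @^-1` S) N - frequency S N| <= N%:R^-1.
Proof.
rewrite /frequency -mulrBl normrM [`|N%:R^-1|]ger0_norm; last by rewrite invr_ge0 ler0n.
rewrite -[leRHS]mul1r ler_wpM2r ?invr_ge0 ?ler0n//.
set F := fun i : nat => (nat_of_bool `[< S i >])%:R : R.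
have F01 i : 0 <= F i <= 1 by rewrite /F; case: asboolP; rewrite ?lexx ?ler01.
have -> : \sum_(i < N) (nat_of_bool `[< (succn @^-1` S) i >])%:R -
    \sum_(i < N) F i = F N - F 0%N.
  rewrite -sumrB -(big_mkord xpredT (fun i => F i.+1 - F i)).
  by rewrite telescope_sumr.
have /andP[? ?] := F01 N; have /andP[? ?] := F01 0%N.
by rewrite ler_norml; apply/andP; split; lra.
Qed.

Lemma invariant_mean : exists m : set nat -> R,
  [/\ m setT = 1, forall S, 0 <= m S,
      forall S S', S `&` S' = set0 -> m (S `|` S') = m S + m S' &
      forall S, m (succn @^-1` S) = m S].
Proof.
(* The ultrafilter refines convergence to infinity, so every bounded sequence gets a limit,
   additively, and the vanishing differences of [frequency_succ] do not affect it. *)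
have [U [UU oU]] := ultraFilterLemma (eventually_filter).
have UP : ProperFilter U by exact: ultra_proper.
have /choice[m /all_and2[m01 mU]] : forall S, exists l : R,
    `[0%R : R, 1%R : R]%classic l /\ frequency S @ U --> l.
  move=> S; have [l l01 Sl] := ultra_cvg UU (@segment_compact R 0 1) (frequency_itv S).
  by exists l.
have cvgm S l : frequency S @ U --> l -> m S = l.
  by move=> Sl; exact: (@cvg_unique _ (@norm_hausdorff _ R) _ _ _ _ (mU S) Sl).
exists m; split.
- apply: cvgm; apply: (@cvg_trans _ (cst 1 @ U)); last exact: cvg_cst.
  apply: near_eq_cvg; apply: oU; exists 1%N => // N /= N0.
  by rewrite frequencyT.
- by move=> S; have := m01 S; rewrite /= in_itv/= => /andP[].
- move=> S S' SS'; apply: cvgm; rewrite (_ : frequency _ = frequency S \+ frequency S').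
    by apply: cvgD.
  by apply/funext => N; exact: frequencyU.
move=> S; apply: cvgm.
rewrite (_ : frequency _ = frequency S \+
    (fun N => frequency (succn @^-1` S) N - frequency S N)); last first.
  by apply/funext => N /=; rewrite subrKC.
rewrite -[X in _ --> X]addr0; apply: cvgD => //.
have : (fun N => frequency (succn @^-1` S) N - frequency S N) @ \oo --> (0 : R).
  apply/cvgrPdist_le => e e0; have := @cvg_harmonic R.
  move=> /cvgrPdist_le /(_ e e0) [n _ ne]; exists n.+1 => // -[//|N] /= nN.
  rewrite sub0r normrN (le_trans (frequency_succ _ _))//.
  by have := ne N nN; rewrite /= sub0r normrN ger0_norm ?harmonic_ge0.
by apply: cvg_trans => B /oU.
Qed.

End invariant_mean.

Lemma probability_of (d : measure_display) (T : measurableType d) (R : realType)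
    (P : set T -> \bar R) : (P set0 = 0)%E -> (forall A, 0 <= P A)%E ->
  semi_sigma_additive P -> (P setT = 1)%E ->
  exists P' : probability T R, P' =1 P.
Proof.
move=> P0 Pge0 Psigma PT.
pose H1 := isMeasure.Build d T R P P0 Pge0 Psigma.
pose m : {measure set T -> \bar R} := HB.pack P H1.
pose H2 := Measure_isProbability.Build d T R m PT.
pose P' := HB.pack_for (probability T R) (Measure.sort m) H2.
by exists P'.
Qed.

Lemma image_probability (d d' : measure_display) (T : measurableType d)
    (T' : measurableType d') (R : realType) (P : probability T R) (f : T -> T') :
  measurable_fun setT f ->
  exists P' : probability T' R, forall A, P' A = P (f @^-1` A).
Proof.
move=> mf; pose H := isMeasurableFun.Build d d' T T' f mf.
pose f' : {mfun T >-> T'} := HB.pack f H.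
by exists (distribution P f').
Qed.

Lemma borel_measurable_fun (S T : ptopologicalType) (f : S -> T) :
  continuous f -> measurable_fun setT (f : borel S -> borel T).
Proof.
move=> /continuousP cf.
apply: (@measurability _ _ (borel S) (borel T) setT f (@open T) erefl).
move=> _ [U oU <-]; rewrite setTI; apply: sub_sigma_algebra; exact: cf.
Qed.

Definition clopen_algebra (T : ptopologicalType) : Type := T.

HB.instance Definition _ (T : ptopologicalType) := Pointed.on (clopen_algebra T).

HB.instance Definition _ (T : ptopologicalType) :=
  isAlgebraOfSets.Build default_measure_display (clopen_algebra T)
    (@clopen0 T) (@clopenU T) (fun A => @clopenC T A A).

Section krylov_bogolyubov.
Context (R : realType) (T : ptopologicalType).
Hypothesis Tcompact : compact [set: T].

(** A finite subcover of the compact union leaves the remaining disjoint members empty. On clopen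
    sets, finite additivity therefore implies sigma-additivity. *)
Lemma clopen_disjoint_finite (F : (set T)^nat) : (forall i, clopen (F i)) ->
  trivIset setT F -> clopen (\bigcup_i F i) ->
  exists N, forall i, (N <= i)%N -> F i = set0.
Proof.
move=> Fo Ft [_ Fc].
have := subclosed_compact Fc Tcompact (@subsetT _ _).
rewrite compact_cover => /(_ nat setT F (fun i _ => (Fo i).1) (@subset_refl _ _)).
move=> [D _ FD]; exists (\max_(i <- finmap.enum_fset D) i.+1)%N => i Di.
apply/seteqP; split=> // x Fix.
have [j /= jD Fjx] := FD x (ex_intro2 _ _ i I Fix).
have ij : i = j by apply: Ft => //; exists x.
have := leq_trans (@leq_bigmax_seq _ _ xpredT (fun i => i.+1) j jD isT) Di.
by rewrite ij ltnn.
Qed.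

Lemma clopen_extension (m : set T -> R) : m setT = 1 -> (forall A, 0 <= m A) ->
  (forall A B, A `&` B = set0 -> m (A `|` B) = m A + m B) ->
  exists P : probability (g_sigma_algebraType (@measurable _ (clopen_algebra T))) R,
    forall A, clopen A -> P A = (m A)%:E.
Proof.
move=> m1 m0 mU; pose mu (A : set (clopen_algebra T)) : \bar R := (m A)%:E.
have ms0 : m set0 = 0.
  have := mU set0 set0 (set0I _); rewrite setU0 => /eqP.
  by rewrite -subr_eq0 opprD addrA subrr sub0r oppr_eq0 => /eqP.
have mu0 : mu set0 = 0%E by rewrite /mu ms0.
have mu_ge0 A : (0 <= mu A)%E by rewrite lee_fin.
have mu_sigma : semi_sigma_additive mu.
  move=> F Fm Ft FUm; have [N FN] := clopen_disjoint_finite Fm Ft FUm.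
  have mun n : (\sum_(0 <= i < n) mu (F i))%E = mu (\big[setU/set0]_(0 <= i < n) F i).
    elim: n => [|n IHn]; first by rewrite !big_geq.
    rewrite !big_nat_recr//= IHn /mu -EFinD mU//.
    apply/seteqP; split=> // x []; rewrite -bigcup_seq => -[i /=].
    rewrite mem_index_iota => /= ni Fix Fnx.
    have /eqP := Ft i n I I (ex_intro _ x (conj Fix Fnx)).
    by rewrite ltn_eqF.
  apply: cvg_near_cst; exists N => // n /= Nn; rewrite mun; congr (mu _).
  apply/seteqP; split=> x.
    by rewrite -bigcup_seq => -[i _ Fix]; exists i.
  move=> [i _ Fix]; rewrite -bigcup_seq; exists i => //=.
  rewrite mem_index_iota /= (leq_trans _ Nn)// ltnNge; apply/negP => /FN Fi.
  by rewrite Fi in Fix.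
(* Caratheodory extension of the premeasure on the algebra of clopen sets. *)
pose H := isMeasure.Build _ (clopen_algebra T) R mu mu0 mu_ge0 mu_sigma.
pose mu' : {measure set (clopen_algebra T) -> \bar R} := HB.pack mu H.
have ext A : clopen A -> measure_extension mu' A = (m A)%:E.
  by move=> cA; rewrite /measure_extension measurable_mu_extE.
have extT : measure_extension mu' setT = 1%E by rewrite ext ?m1//; exact: clopenT.
have [P PE] := @probability_of _ _ R (measure_extension mu')
  (measure0 _) (measure_ge0 _) (@measure_semi_sigma_additive _ _ _ _) extT.
by exists P => A cA; rewrite PE ext.
Qed.

Context (I : countType) (C : I -> set T).
Hypothesis Cclopen : forall i, clopen (C i).
Hypothesis Cbase : forall U x, open U -> U x -> exists i, C i x /\ C i `<=` U.

(** With a countable base of clopen sets, every open set is a countable union of clopen sets. *)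
Lemma borel_clopenE : <<s @open T >> = <<s @clopen T >>.
Proof.
apply/seteqP; split; last first.
  apply: smallest_sub; first exact: smallest_sigma_algebra.
  by move=> A [oA _]; exact: sub_gen_smallest.
apply: smallest_sub; first exact: smallest_sigma_algebra.
move=> U oU.
rewrite (_ : U = \bigcup_i (if `[< C i `<=` U >] then C i else set0)).
  apply: (@countable_bigcupT_measurable _ (g_sigma_algebraType (@clopen T))) => [|i].
    exact: countableP.
  case: ifP => _; last exact: measurable0.
  by apply: sub_sigma_algebra.
apply/seteqP; split=> [x Ux|x [i _]]; last by case: asboolP => // CU /CU.
by have [i [Cx CU]] := Cbase oU Ux; exists i => //; rewrite asboolT.
Qed.

Lemma invariant_measure_exists (s : T -> T) : continuous s ->
  exists nu : probability (borel T) R, invariant_measure s nu.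
Proof.
move=> sc; have [m [m1 m0 mU mS]] := invariant_mean R.
(* Times at which the orbit of [point] visits [A]; taking the preimage of [A] under [s] shifts these
   times by one. *)
pose visits (A : set T) : set nat := [set i | A (iter i s point)].
have [||A B AB|P PE] := @clopen_extension (m \o visits).
- by rewrite -[RHS]m1; congr m; apply/seteqP.
- by move=> A; exact: m0.
- rewrite /= -mU//; apply/seteqP; split=> // i [Ai Bi].
  by have : (A `&` B) (iter i s point) by []; rewrite AB.
have mid : measurable_fun setT
    (id : g_sigma_algebraType (@measurable _ (clopen_algebra T)) -> borel T).
  by move=> _ B mB; rewrite setTI; move: mB; rewrite /measurable/= borel_clopenE.
have [nu nuE] := image_probability P mid.
have [nu' nu'E] := image_probability nu (borel_measurable_fun sc).
exists nu => B mB; rewrite -nu'E.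
(* The clopen sets are stable under intersection and generate, so invariance has to be checked only
   on them. *)
apply: (@g_sigma_algebra_measure_unique _ R (borel T) (@clopen T) _ (fun=> setT)) => //.
- by move=> A [oA _]; exact: sub_sigma_algebra.
- by move=> _; exact: clopenT.
- by rewrite bigcup_const.
- exact: clopenI.
- move=> A cA; apply: etrans (nu'E A) _; rewrite !nuE.
  apply: etrans (PE _ (preimage_clopen cA sc)) _.
  apply: etrans _ (esym (etrans (nuE A) (PE _ cA))).
  by congr EFin; rewrite /= -[RHS]mS.
- by move=> _; exact: le_lt_trans (probability_le1 nu' measurableT) (ltry _).
- by rewrite -borel_clopenE.
Qed.

End krylov_bogolyubov.

(** * Invariant measures of the extension *)

Lemma mnormalizeE (d : measure_display) (T : measurableType d) (R : realType)
    (mu : {measure set T -> \bar R}) (P : probability T R) (r : R) (B : set T) :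
  0 < r -> mu setT = r%:E -> mnormalize mu P B = (mu B * r^-1%:E)%E.
Proof. by move=> r0 muT; rewrite /mnormalize muT /= eqe gt_eqF. Qed.

Section eventually_fixed.
Context (R : realType) (D V : ptopologicalType).
Context (f : D -> D) (s : V -> V) (c : D) (phi : V -> D).
Hypothesis Dhausdorff : hausdorff_space D.
Hypothesis Vcompact : compact [set: V].
Hypothesis f_continuous : continuous f.
Hypothesis f_c : f c = c.
Hypothesis phi_continuous : continuous phi.
Hypothesis phi_inj : injective phi.
Hypothesis phi_conj : forall v, phi (s v) = f (phi v).
Hypothesis c_notin : ~ range phi c.
Hypothesis eventually_c : forall p, ~ range phi p -> exists n, iter n f p = c.

Let W : set (borel D) := range phi.

Lemma closed_image (K : set V) : closed K -> closed (phi @` K).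
Proof.
move=> Kc; apply: compact_closed => //; apply: continuous_compact.
  exact/continuous_subspaceT.
by apply: subclosed_compact Vcompact _.
Qed.

Lemma borel_open (T : ptopologicalType) (U : set T) :
  open U -> measurable (U : set (borel T)).
Proof. exact: sub_sigma_algebra. Qed.

Lemma borel_closed (T : ptopologicalType) (K : set T) :
  closed K -> measurable (K : set (borel T)).
Proof.
move=> Kc; rewrite -[K]setCK; apply: measurableC; apply: borel_open.
exact: closed_openC.
Qed.

Let mW : measurable W.
Proof. by apply: borel_closed; exact: closed_image closedT. Qed.

Let mc : measurable ([set c] : set (borel D)).
Proof.
by apply: borel_closed; apply: compact_closed => //; exact: compact_set1.
Qed.

(** A Borel left inverse of [phi], constant off its range; it carries the restriction of [mu] back
    to [V]. *)
Let psi (p : borel D) : borel V :=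
  if pselect (exists v, phi v = p) is left e then projT1 (cid e) else point.

Let psiK v : psi (phi v) = v.
Proof.
rewrite /psi; case: pselect => [e|[]]; last by exists v.
exact/phi_inj/(projT2 (cid e)).
Qed.

Let psi_measurable : measurable_fun setT psi.
Proof.
apply: (@measurability _ _ (borel D) (borel V) setT psi (@open V) erefl).
move=> _ [U oU <-]; rewrite setTI.
(* On the range, [phi] maps the closed complement of [U] to a closed set; off the range, membership
   depends only on [point]. *)
rewrite (_ : psi @^-1` U = (W `&` ~` (phi @` (~` U))) `|`
    (~` W `&` [set _ | U point])).
  apply: measurableU; apply: measurableI; [exact: mW| |exact: measurableC|].
    apply: measurableC; apply: borel_closed; apply: closed_image.
    exact: open_closedC.
  have [Up|Up] := pselect (U point).
    rewrite (_ : mkset _ = setT); first exact: measurableT.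
    by apply/seteqP; split=> // p _; exact: Up.
  rewrite (_ : mkset _ = set0); first exact: measurable0.
  by apply/seteqP; split=> // p /Up.
apply/seteqP; split=> [p Up|p].
  have [[v _ vp]|nWp] := pselect (W p).
    left; split; first by exists v.
    by move=> [u nUu up]; apply: nUu; rewrite -(psiK u) up.
  right; split=> //; move: Up; rewrite /= /psi; case: pselect => // e.
  by case: nWp; case: e => v vp; exists v.
case=> [[[v _ <-] H]|[nWp Up]] /=.
  by rewrite psiK; apply: contrapT => nUv; apply: H; exists v.
rewrite /psi; case: pselect => // e.
by case: nWp; case: e => v vp; exists v.
Qed.

Section invariant.
Context (mu : probability (borel D) R).
Hypothesis mu_inv : invariant_measure f mu.
Local Open Scope ereal_scope.

Let iter_continuous n : continuous (iter n f).
Proof.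
elim: n => [|n IHn] x; first exact: cvg_id.
by apply: continuous_comp; [exact: IHn|exact: f_continuous].
Qed.

Let stage n : set (borel D) := [set p | iter n f p = c].

Let measurable_stage n : measurable (stage n).
Proof.
rewrite -[stage n]setTI; by apply: (borel_measurable_fun (@iter_continuous n)) mc.
Qed.

Let mu_stage n : mu (stage n) = mu [set c].
Proof.
elim: n => [|n <-]; first by congr (mu _); apply/seteqP.
rewrite -(mu_inv (measurable_stage n)); congr (mu _).
by apply/seteqP; split=> p; rewrite /stage/= -iterSr.
Qed.

Let bigcup_stage : \bigcup_n stage n = ~` W.
Proof.
apply/seteqP; split=> [p [n _ pn]|p /eventually_c[n pn]]; last by exists n.
move=> [v _ vp]; apply: c_notin; rewrite -pn -vp.
exists (iter n s v) => //; elim: n {pn} => //= n <-.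
by rewrite phi_conj.
Qed.

(** The sets [stage n] are iterated preimages of [{c}], all of the same mass by invariance, and
    increase to the complement of [W]. *)
Lemma invariant_transient : mu (~` W) = mu [set c].
Proof.
have : mu (stage n) @[n --> \oo] --> mu (\bigcup_n stage n).
  apply: nondecreasing_cvg_mu => //; first exact: bigcup_measurable.
  apply/nondecreasing_seqP => n; apply/subsetPset => p.
  by rewrite /stage/= => ->.
rewrite bigcup_stage (_ : (fun n => mu (stage n)) = cst (mu [set c])); last exact/funext.
by move=> /cvg_lim <-//; rewrite lim_cst.
Qed.

Lemma invariant_split (B : set (borel D)) : measurable B ->
  mu B = mu [set c] * \d_(c : borel D) B + mu (B `&` W).
Proof.
move=> mB; rewrite (measureDI _ mB mW); congr (_ + _).
have mBW : measurable (B `\` W) by exact: measurableD.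
have cW : ~` W `&` [set c] = [set c] by apply/seteqP; split=> [p []//|p ->].
(* By [invariant_transient], all the mass outside [W] sits at [c]. *)
have zero : mu (~` W `\` [set c]) = 0.
  have Woo : mu (~` W) < +oo.
    exact: le_lt_trans (probability_le1 mu (measurableC mW)) (ltry _).
  apply: etrans (measureD (measurableC mW) mc Woo) _; rewrite cW.
  apply: etrans (congr1 (fun x => x - mu [set c]) invariant_transient) _.
  by rewrite subee// fin_num_measure.
rewrite (measureDI _ mBW mc) (@subset_measure0 _ _ _ _ _ (~` W `\` [set c])) ?add0e//;
  last 3 first.
- exact: measurableD.
- by apply: measurableD => //; exact: measurableC.
- by move=> p [[_ nWp] pc].
rewrite diracE; have [cB|cB] := boolP (c \in B).
  rewrite mule1; congr (mu _); apply/seteqP; split=> [p []//|p ->].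
  by split=> //; split; [exact: set_mem cB|exact: c_notin].
rewrite mule0 -[RHS](measure0 mu); congr (mu _); apply/seteqP; split=> // p [[Bp _] pc].
by move: cB; rewrite -pc => /negP; apply; exact/mem_set.
Qed.

Lemma invariant_recurrent : mu W = 1 - mu [set c].
Proof.
have := probability_setC mu (measurableC mW).
by rewrite setCK invariant_transient.
Qed.

Lemma invariant_decomposition (nu0 : probability (borel V) R) :
  invariant_measure s nu0 ->
  exists (t : R) (nu : probability (borel V) R),
    [/\ (0 <= t <= 1)%R, invariant_measure s nu &
        forall B : set (borel D), measurable B ->
          mu B = t%:E * \d_(c : borel D) B +
            (1 - t)%:E * pushforward nu (phi : borel V -> borel D) B].
Proof.
move=> nu0_inv; have mphi := borel_measurable_fun phi_continuous.
have cfin : mu [set c] \is a fin_num by exact: fin_num_measure.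
pose t := fine (mu [set c]); have tE : mu [set c] = t%:E by rewrite fineK.
have t0 : (0 <= t)%R by rewrite -lee_fin -tE.
have t1 : (t <= 1)%R by rewrite -lee_fin -tE probability_le1.
have WE : mu W = (1 - t)%:E by rewrite invariant_recurrent tE.
exists t; have [te|t_neq1] := eqVneq t 1%R.
  (* All mass is at [c]: the second term has coefficient 0 and [nu0] merely fills its place. *)
  exists nu0; split=> // [|B mB]; first by rewrite t0 t1.
  rewrite (invariant_split mB) tE te subrr mul0e; congr (_ + _).
  apply: (@subset_measure0 _ _ _ _ _ W) => //; first exact: measurableI.
  by apply: etrans WE _; rewrite te subrr.
have t_gt0 : (0 < 1 - t)%R by rewrite subr_gt0 lt_neqAle t_neq1.
pose rho := mnormalize (mrestr mu mW) mu.
have rhoE B : rho B = mu (B `&` W) * (1 - t)^-1%:E.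
  by apply: mnormalizeE => //; apply: etrans WE; rewrite /= /mrestr setTI.
have [nu nuE] := image_probability (rho : probability (borel D) R) psi_measurable.
have {nuE}nuE B : nu B = mu (psi @^-1` B `&` W) * (1 - t)^-1%:E.
  exact: etrans (nuE B) (rhoE _).
(* The preimage of [E] misses [c], since [c] is fixed and outside [W]; hence its part outside [W] is
   null. *)
have invE (E : set (borel D)) : measurable E -> E `<=` W ->
    mu (f @^-1` E `&` W) = mu E.
  move=> mE EW; have mfE : measurable (f @^-1` E : set (borel D)).
    by rewrite -[X in measurable X]setTI; exact: (borel_measurable_fun f_continuous).
  rewrite -(mu_inv mE) (invariant_split mfE) diracE memNset ?mule0 ?add0e//.
  by rewrite /= f_c => /EW /c_notin.
exists nu; split=> [||B mB]; first by rewrite t0 t1.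
- move=> B mB; rewrite !nuE; congr (_ * _).
  have mpB : measurable (psi @^-1` B : set (borel D)).
    by rewrite -[X in measurable X]setTI; exact: psi_measurable.
  rewrite -[RHS]invE; [|exact: measurableI|by move=> p []].
  congr (mu _); apply/seteqP; split=> p [Bp [v _ vp]]; split; try by exists v.
    move: Bp; rewrite -vp /= psiK -phi_conj psiK => Bv.
    by split=> //; exists (s v).
  by move: Bp; rewrite -vp /= -phi_conj !psiK => -[].
rewrite (invariant_split mB) tE; congr (_ + _).
rewrite /pushforward nuE muleCA -EFinM divff ?gt_eqF// mule1.
congr (mu _); apply/seteqP; split=> p [Bp [v _ vp]]; split; try by exists v.
  by rewrite -vp /= psiK vp.
by move: Bp; rewrite -vp /= psiK.
Qed.

End invariant.

End eventually_fixed.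

(** * Cylinder sets and the topology of a subshift *)

Lemma nbhs_cylinder (T : nat -> topologicalType) (x : prod_topology T)
    (B : set (prod_topology T)) : nbhs x B ->
  exists n, [set y | forall i, (i < n)%N -> x i = y i] `<=` B.
Proof.
move: B; pose F := filter_from [set: nat]
  (fun n => [set y : prod_topology T | forall i, (i < n)%N -> x i = y i]).
suff : F --> x by move=> Fx B /Fx [n _ nB]; exists n.
have FF : Filter F.
  apply: filter_from_filter; first by exists 0%N.
  move=> m n _ _; exists (maxn m n) => // y xy.
  by split=> i im; apply: xy; rewrite leq_max im ?orbT.
apply: (@prod_topology_cvg _ _ F) => i B /nbhs_singleton Bx.
by exists i.+1 => // y /(_ i (ltnSn i)) xy; rewrite /= -xy.
Qed.

Section subshift_topology.
Context (A : finType) (V : subshift A).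
Implicit Types (v : subshift_space V) (B : set (subshift_space V)) (n : nat).

Definition cylinder v n : set (subshift_space V) :=
  [set u | forall i, (i < n)%N -> set_val v i = set_val u i].

Lemma nbhs_subshiftP v B : nbhs v B <-> exists n, cylinder v n `<=` B.
Proof.
split=> [|[n nB]].
  rewrite nbhsE => -[_ [[U oU <-] Uv] sB].
  have [n nU] := nbhs_cylinder (open_nbhs_nbhs (conj oU Uv)).
  by exists n => u /nU /sB.
apply: (@filterS _ (nbhs v) (nbhs_filter v) _ _ nB).
have vn : nbhs (set_val v : full_shift A)
    [set y | forall i, (i < n)%N -> set_val v i = y i].
  by apply: (@near_cylinder (fun=> discrete_topology A)) => i; exact: discrete_set1.
exact: initial_continuous vn.
Qed.

Lemma subshift_map_continuous : continuous (@subshift_map A V).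
Proof.
(* The shift consumes one coordinate, hence [n.+1]. *)
move=> v B /nbhs_subshiftP[n nB]; apply/nbhs_subshiftP; exists n.+1 => u vu.
by apply: nB => i ni; exact: vu.
Qed.

(** Indexing by finite words instead of points makes the clopen base countable. The [nth] default is
    never read within the word. *)
Definition word_cylinder (w : seq A) : set (subshift_space V) :=
  [set u | forall i, (i < size w)%N -> nth (set_val u i) w i = set_val u i].

Lemma cylinder_wordE v n : cylinder v n = word_cylinder (mkseq (set_val v) n).
Proof.
apply/seteqP; split=> u vu i.
  by rewrite size_mkseq => ni; rewrite nth_mkseq// vu.
by move=> ni; have := vu i; rewrite size_mkseq nth_mkseq//; apply.
Qed.

Lemma word_cylinder_clopen w : clopen (word_cylinder w).
Proof.
have agree_nth u v i : cylinder u (size w) v -> (i < size w)%N ->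
    nth (set_val u i) w i = set_val u i <-> nth (set_val v i) w i = set_val v i.
  by move=> uv iw; rewrite -(uv i iw).
split.
  rewrite openE => u uw; apply/nbhs_subshiftP; exists (size w) => v uv i iw.
  exact/(agree_nth _ _ _ uv iw)/uw.
rewrite -[X in closed X]setCK; apply: open_closedC; rewrite openE => u uw.
apply/nbhs_subshiftP; exists (size w) => v uv vw; apply: uw => i iw.
exact/(agree_nth _ _ _ uv iw)/vw.
Qed.

Lemma word_cylinder_base (U : set (subshift_space V)) v : open U -> U v ->
  exists w, word_cylinder w v /\ word_cylinder w `<=` U.
Proof.
rewrite openE => oU /oU /nbhs_subshiftP[n nU].
by exists (mkseq (set_val v) n); rewrite -cylinder_wordE.
Qed.

End subshift_topology.

Theorem theorem1p5 (R : realType) :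
  exists D : pmetricType R, gehman_dendrite D /\
    forall (A : finType) (V : subshift A),
    exists (f : D -> D) (c : D) (phi : subshift_space V -> D),
      [/\ continuous f /\ f c = c,
          continuous phi /\ injective phi,
          (forall x, phi (subshift_map x) = f (phi x)) &
          forall mu : probability (borel D) R, invariant_measure f mu ->
            exists (t : R) (nu : probability (borel (subshift_space V)) R),
              [/\ 0 <= t <= 1,
                  invariant_measure (@subshift_map A V) nu &
                  forall B : set (borel D), measurable B ->
                    mu B = (t%:E * \d_(c : borel D) B +
                      (1 - t)%:E * pushforward nu
                        (phi : borel (subshift_space V) -> borel D) B)%E]].
Proof.
exists (tree R); split; first exact: gehman_tree.
move=> A V; exists (shift_tree V), (tree_root R), (@embed R A V).
have fc := @shift_tree_continuous R A V.
have fr := @shift_tree_root R A V.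
have pc := @embed_continuous R A V.
have pinj := @embed_inj R A V.
have conj := @embed_shift R A V.
split=> //.
have [nu0 nu0_inv] := invariant_measure_exists R (@subshift_compact A V)
  (@word_cylinder_clopen A V) (@word_cylinder_base A V)
  (@subshift_map_continuous A V).
move=> mu mu_inv.
exact: (invariant_decomposition (@metric_hausdorff _ _) (@subshift_compact A V)
  fc fr pc pinj conj (@root_notin_embed R A V) (@shift_tree_eventually_root R A V)
  mu_inv nu0_inv).
Qed.
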